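(* Let $\mathcal{A}$ be a normalized linear switching system in $\mathbb{R}^d$ possessing an invariant norm $f$, with respect to which extremality is understood. Then every extremal ivy of $\mathcal{A}$ different from $\{0\}$ is an eigenset of $\mathcal{A}$. Conversely, if in addition $\mathcal{A}$ is irreducible, then every eigenset of $\mathcal{A}$ is a union of some set of extremal ivies.
   Context: A linear switching system in $\mathbb{R}^d$ is identified with its control set $\mathcal{A}$, a nonempty compact set of real $d\times d$ matrices. A switching law is a measurable function $A(\cdot):[0,\infty)\to\mathcal{A}$. A trajectory is an absolutely continuous function $x:[0,\infty)\to\mathbb{R}^d$ such that, for some switching law, $\dot x(t)=A(t)x(t)$ for almost every $t$. Standing assumption: $\mathcal{A}$ is convex and does not contain the zero matrix. For a compact set $M\subset\mathbb{R}^d$ and $t\ge 0$, $M_t$ denotes the set of points $x(t)$ over all trajectories with $x(0)\in M$. An eigenset of $\mathcal{A}$ is a compact set $M\subset\mathbb{R}^d$, $M\neq\emptyset$, $M\ne\{0\}$, for which there is a constant $\alpha\in\mathbb{R}$ with $M_t=e^{\alpha t}M$ for all $t\ge 0$. The Lyapunov exponent $\sigma(\mathcal{A})$ is the infimum of all $\beta\in\mathbb{R}$ such that every trajectory satisfies $\|x(t)\|\le C e^{\beta t}$ for all $t\ge 0$ with a constant $C$ depending on the trajectory. The system is normalized if $\sigma(\mathcal{A})=0$, and irreducible if the matrices of $\mathcal{A}$ have no common invariant linear subspace other than $\{0\}$ and $\mathbb{R}^d$. An invariant (Barabanov) norm of a normalized system is a norm $f$ on $\mathbb{R}^d$ such that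 (a) $f(x(t))$ is non-increasing in $t$ along every trajectory, and (b) for every $x_0\in\mathbb{R}^d$ there is a trajectory $\bar x$ with $\bar x(0)=x_0$ and $f(\bar x(t))$ constant on $[0,\infty)$. (By a known theorem of Barabanov, every irreducible system with convex control set has an invariant norm.) A stem is an absolutely continuous map $x:\mathbb{R}\to\mathbb{R}^d$ such that $\dot x(t)=A(t)x(t)$ for almost every $t\in\mathbb{R}$ with some measurable $A(\cdot):\mathbb{R}\to\mathcal{A}$; it is also identified with its image. The ivy of a stem is the closure of the set of all points reachable from the stem, i.e. of all points $y(t)$, $t\ge 0$, where $y$ is a trajectory with $y(0)$ in the stem. A stem is extremal if $f(x(t))$ is constant on $\mathbb{R}$; the ivy of an extremal stem is called an extremal ivy. *)

(* Defs.v *)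
From mathcomp Require Import all_boot all_order all_algebra.
From mathcomp Require Import all_classical all_reals all_analysis.

Set Implicit Arguments.
Unset Strict Implicit.
Unset Printing Implicit Defensive.

Import Order.TTheory GRing.Theory Num.Theory.
Import numFieldNormedType.Exports.

Local Open Scope classical_set_scope.
Local Open Scope ring_scope.

Section LinearSwitchingSystems.
Context {R : realType} {d : nat}.

Implicit Types (A : set 'M[R]_d) (D : set R) (x : R -> 'cV[R]_d).
Implicit Types (M P : set 'cV[R]_d) (f : 'cV[R]_d -> R).

Definition switching_system A : Prop :=
  [/\ A !=set0, compact A,
      convex_set (A : set (convex_lmodType 'M[R]_d)) & ~ A 0].

(* Absolute continuity on every compact subinterval of D: on an unbounded
   interval this is the usual convention for solutions of differential
   equations (t |-> expR t is not uniformly continuous on [0, +oo[). *)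
Definition abs_continuous D x : Prop :=
  forall a b : R, a <= b -> `[a, b] `<=` D ->
  forall e : R, 0 < e -> exists2 delta : R, 0 < delta &
  forall (n : nat) (u v : 'I_n -> R),
    (forall i, [/\ a <= u i, u i <= v i & v i <= b]) ->
    trivIset setT (fun i => `]u i, v i[%classic) ->
    \sum_(i < n) (v i - u i) < delta ->
    \sum_(i < n) `|x (v i) - x (u i)| < e.

(* Only the values of x and of B on D are constrained (a switching law defined
   on D is extended arbitrarily outside D); when D = [0, +oo[, the two-sided
   derivative is unavailable only at t = 0, which is a null set.  Measurability
   is Borel; replacing a Lebesgue measurable switching law by a Borel one that
   agrees with it almost everywhere does not change the solutions. *)
Definition solution A D x : Prop :=
  abs_continuous D x /\
  exists B : R -> 'M[R]_d,
    [/\ forall t, D t -> A (B t),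
        forall i j, measurable_fun D (fun t => B t i j) &
        {ae lebesgue_measure, forall t, D t -> is_derive t 1 x (B t *m x t)}].

Definition trajectory A x : Prop := solution A `[0, +oo[ x.

Definition stem A x : Prop := solution A setT x.

Definition flow A M (t : R) : set 'cV[R]_d :=
  [set x t | x in [set x | trajectory A x /\ M (x 0)]].

Definition eigenset A M : Prop :=
  [/\ compact M, M !=set0, M <> [set 0] &
      exists alpha : R, forall t : R, 0 <= t ->
        flow A M t = [set expR (alpha * t) *: p | p in M]].

(* `|x t| is the maximum norm; the exponent does not depend on the norm. *)
Definition lyapunov_exponent A : \bar R :=
  ereal_inf [set beta%:E | beta in [set beta : R |
    forall x, trajectory A x ->
      exists C : R, forall t : R, 0 <= t -> `|x t| <= C * expR (beta * t)]].

Definition normalized A : Prop := lyapunov_exponent A = 0%:E.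

Definition irreducible A : Prop :=
  forall V : {vspace 'cV[R]_d},
    (forall B, A B -> forall v, v \in V -> B *m v \in V) ->
    V = 0%VS \/ V = fullv.

Definition is_norm f : Prop :=
  [/\ forall v, 0 <= f v,
      forall v, f v = 0 -> v = 0,
      forall (c : R) v, f (c *: v) = `|c| * f v &
      forall v w, f (v + w) <= f v + f w].

Definition invariant_norm A f : Prop :=
  [/\ is_norm f,
      forall x, trajectory A x ->
        forall s t : R, 0 <= s -> s <= t -> f (x t) <= f (x s) &
      forall v, exists x,
        [/\ trajectory A x, x 0 = v & forall t : R, 0 <= t -> f (x t) = f v]].

Definition extremal_stem A f x : Prop :=
  stem A x /\ forall s t : R, f (x s) = f (x t).

Definition ivy A x : set 'cV[R]_d :=
  closure (\bigcup_(t in `[0, +oo[) flow A (range x) t).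

Definition extremal_ivy A f P : Prop :=
  exists2 x, extremal_stem A f x & P = ivy A x.

End LinearSwitchingSystems.

(* Main.v *)
(* The exponent of an eigenset is 0: invariant trajectories keep f constant,
   and no trajectory increases f.  Hence eigensets are exactly the nontrivial
   compact sets M with M_t = M.

   Concatenating and shifting trajectories shows that the set reachable from an
   extremal stem is mapped onto itself by the flow; both inclusions pass to the
   closure, one by the continuous dependence of trajectories on the initial
   point for a fixed law (the difference is again a trajectory, so f of it does
   not increase), the other by compactness of the set of trajectories.

   Conversely, let M_t = M and let p be in M.  Compactness yields a stem x in M
   through p; f is monotone along x, so a limit z of the shifts x(. - k) is an
   extremal stem in M.  Since z(0) is close to x(-k), and x goes from x(-k) to
   p, continuous dependence puts p in the ivy of z, which lies in M.

   Compactness is obtained by replacing the equation x' = B x by a condition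
   without derivatives or measurability, stable under pointwise limits: with a
   primitive beta of B, the difference quotients of beta are in A and
   x(t) - x(s) - (beta(t) - beta(s)) x(s) = O((t - s)^2). *)
Require Import Defs.
From HB Require Import structures.
From mathcomp Require Import all_boot all_order all_algebra.
From mathcomp Require Import all_classical all_reals all_analysis.
From mathcomp Require Import measurable_realfun ring lra.

Set Implicit Arguments.
Unset Strict Implicit.
Unset Printing Implicit Defensive.

Import Order.TTheory GRing.Theory Num.Theory.
Import numFieldNormedType.Exports.

Local Open Scope classical_set_scope.
Local Open Scope ring_scope.

(** * Increments of absolutely continuous functions *)

(** The obstacle is that laws are merely measurable, while compactness only provides pointwise
    limits of trajectories, along which derivatives need not converge. To reach the derivative-free
    condition, derivatives known almost everywhere must control increments; a covering argument does
    this, absolute continuity paying for the exceptional null set. In the other direction a limit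
    [beta] is only known to be Lipschitz, and Lebesgue differentiation recovers a measurable law
    from it. The constants [K * m] and [K ^+ 2 * m] depend only on a bound [K] for the matrices and
    a bound [m] for the trajectory; the invariant norm supplies one [m] for all trajectories
    starting in a bounded set, so the condition is uniform along sequences. In the converse, the
    time needed to get from [z 0] close to [p] tends to infinity, so a Gronwall estimate would be
    useless: the dependence on the initial point must be uniform in time, and this is what [f]
    gives. It requires solving the equation with a given measurable law from any initial point,
    hence the Picard iteration. *)

Definition ac_size (R : realType) (a b : R) (w : R -> R -> R) :=
  forall e : R, 0 < e -> exists2 delta : R, 0 < delta &
  forall (n : nat) (u v : 'I_n -> R),
    (forall i, [/\ a <= u i, u i <= v i & v i <= b]) ->
    trivIset setT (fun i => `]u i, v i[%classic) ->
    \sum_(i < n) (v i - u i) < delta ->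
    \sum_(i < n) w (u i) (v i) < e.

Lemma negligible_open_cover (R : realType) (N : set R) (e : R) :
  lebesgue_measure.-negligible N -> 0 < e ->
  exists U : set R, [/\ open U, N `<=` U & (lebesgue_measure U < e%:E)%E].
Proof.
move=> /negligible_outer_measure N0 e0.
have e20 : 0 < e / 2 by rewrite divr_gt0.
have [U [oU NU mU]] := outer_measure_open_le N e20.
exists U; split=> //; apply: (le_lt_trans mU).
by rewrite N0 add0e lte_fin ltr_pdivrMr// ltr_pMr// ltr1n.
Qed.

Lemma sum_length_le (R : realType) (U : set R) (n : nat) (u v : 'I_n -> R) (d : R) :
  open U -> (lebesgue_measure U < d%:E)%E ->
  (forall i, u i <= v i) -> (forall i, `]u i, v i[ `<=` U) ->
  trivIset setT (fun i => `]u i, v i[%classic) ->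
  \sum_(i < n) (v i - u i) < d.
Proof.
move=> oU mU uv uvU tI.
rewrite -lte_fin; apply: le_lt_trans mU.
rewrite -sumEFin.
have -> : (\sum_(i < n) (v i - u i)%:E =
    \sum_(i < n) lebesgue_measure `]u i, v i[%classic)%E.
  apply: eq_bigr => i _; rewrite lebesgue_measure_itv/= lte_fin EFinB.
  case: ltP => // vu; have -> : v i = u i by apply/le_anti; rewrite vu uv.
  by rewrite subee.
rewrite -measure_bigsetU_ord//.
apply: le_measure; rewrite ?inE//.
- exact: bigsetU_measurable.
- exact: open_measurable.
- by elim/big_ind : _ => // A B AU BU x [/AU|/BU].
Qed.

(* Cousin-style covering argument: points outside N have small intervals on
   which Q holds with slope e; those in N lie in an open set of small measure,
   whose contribution is controlled by absolute continuity of w. *)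
Lemma ac_cousin (R : realType) (a b : R) (w : R -> R -> R) (N : set R)
    (Q : R -> R -> R -> Prop) :
  a <= b -> ac_size a b w -> lebesgue_measure.-negligible N ->
  Q a a 0 ->
  (forall s t u e e', a <= s -> s <= t -> t <= u -> u <= b ->
     Q s t e -> Q t u e' -> Q s u (e + e')) ->
  (forall s t e e', e <= e' -> Q s t e -> Q s t e') ->
  (forall s t, a <= s -> s <= t -> t <= b -> Q s t (w s t)) ->
  (forall t, a <= t <= b -> ~ N t -> forall e, 0 < e ->
     exists2 r : R, 0 < r & forall s u, a <= s -> s <= t -> t <= u -> u <= b ->
       u - s < r -> Q s u (e * (u - s))) ->
  forall e, 0 < e -> Q a b e.
Proof.
move=> ab ACw N0 Qaa Qadd Qle Qw Qloc eta eta0.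
have [delta delta0 Hdelta] := ACw _ (divr_gt0 eta0 (ltr0Sn R 1)).
have [U [oU NU mU]] := negligible_open_cover N0 delta0.
(* The budget [eta] is split: [eta / 2] for the intervals inside [U], and a slope with
   [e * (b - a) <= eta / 2] elsewhere; the [1] keeps the denominator positive when [a = b]. *)
pose e := eta / 2 / (b - a + 1).
have ba1 : 0 < b - a + 1 by rewrite ltr_wpDl ?subr_ge0.
have e0 : 0 < e by rewrite !divr_gt0.
(* [t] is good when the error on [[a, t]] is paid by the slope [e] and finitely many intervals
   inside [U], listed from left to right so that a new one can be appended. *)
pose good (t : R) := a <= t <= b /\ exists n (u v : nat -> R),
  [/\ forall i, (i < n)%N -> [/\ a <= u i, u i <= v i, v i <= t & `]u i, v i[ `<=` U],
      forall i j, (i < j)%N -> (j < n)%N -> v i <= u j &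
      Q a t (e * (t - a) + \sum_(i < n) w (u i) (v i))].
have good_a : good a.
  split; first by rewrite lexx ab.
  exists 0%N, (fun=> 0), (fun=> 0); split=> //.
  by rewrite big_ord0 addr0 subrr mulr0.
have step1 s u : good s -> s <= u -> u <= b -> Q s u (e * (u - s)) -> good u.
  move=> [/andP[as_ sb]] [n [p [q [pq pqI Qs]]]] su ub Qsu; split.
    by rewrite ub (le_trans as_).
  exists n, p, q; split=> //.
    by move=> i ni; have [? ? ? ?] := pq i ni; split=> //; apply: le_trans su.
  have := Qadd _ _ _ _ _ (lexx a) as_ su ub Qs Qsu; apply: Qle.
  by rewrite addrAC -mulrDr [s - a + _]addrC subrKA.
have step2 s u : good s -> s <= u -> u <= b -> `]s, u[ `<=` U -> good u.
  move=> [/andP[as_ sb]] [n [p [q [pq pqI Qs]]]] su ub suU; split.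
    by rewrite ub (le_trans as_).
  exists n.+1, (fun i => if (i < n)%N then p i else s),
    (fun i => if (i < n)%N then q i else u); split.
  - move=> i; rewrite ltnS => lein; case: ltnP => ni.
      by have [? ? ? ?] := pq i ni; split=> //; apply: le_trans su.
    by split.
  - move=> i j ij; rewrite ltnS => jn.
    have -> : (i < n)%N by apply: leq_trans jn.
    case: ltnP => jn'; first exact: pqI.
    by have [] := pq i (leq_trans ij jn).
  - have Qsu := Qw _ _ as_ su ub.
    have := Qadd _ _ _ _ _ (lexx a) as_ su ub Qs Qsu; apply: Qle.
    rewrite big_ord_recr/= ltnn.
    under [in leRHS]eq_bigr do rewrite ltn_ord.
    by rewrite -addrA lerD2r ler_wpM2l ?(ltW e0)// lerD2r.
have local t : a <= t <= b -> exists2 r, 0 < r &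
    forall s u, a <= s -> s <= t -> t <= u -> u <= b ->
      u - s < r -> good s -> good u.
  move=> tab; have [Nt|Nt] := pselect (N t).
    have /nbhs_ballP[r/= r0 rU] : nbhs t U.
      by apply: open_nbhs_nbhs; split=> //; exact: NU.
    exists r => // s u as_ st tu ub usr gs; apply: (step2 s) => //.
      exact: le_trans tu.
    move=> x; rewrite /= in_itv/= => /andP[sx xu]; apply: rU.
    rewrite /ball/= ltr_norml; apply/andP; split; lra.
  have [r r0 H] := Qloc t tab Nt e e0.
  exists r => // s u as_ st tu ub usr gs; apply: (step1 s) => //.
    exact: le_trans tu.
  exact: H.
have supS : has_sup good.
  split; first by exists a.
  by exists b => t [/andP[]].
pose c := sup good.
have cab : a <= c <= b.
  rewrite /c; apply/andP; split; first exact: sup_upper_bound.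
  by apply: ge_sup; [exists a|move=> t [/andP[]]].
have [r r0 Hr] := local c cab.
have [s gs sc] := sup_adherent (divr_gt0 r0 (ltr0Sn R 1)) supS.
have sc' : s <= c by exact: sup_upper_bound.
have as_ : a <= s by case: gs => /andP[].
(* Since [s] is within [r / 2] of [c], and [r / 2 + r / 3 < r], [u] is good; being at most the
   supremum [c], it can only be [b]. *)
pose u := Num.min b (c + r / 3).
have gu : good u.
  have /andP[ac cb] := cab.
  apply: (Hr s u) => //; rewrite /u ?ge_min ?lexx// ?le_min ?cb/=.
    by lra.
  rewrite /c in sc *; case: (leP b) => H; rewrite -/c in sc H *; lra.
have ub : u = b.
  have := sup_upper_bound supS gu; rewrite -/c /u => H.
  apply/eqP; rewrite eq_le ge_min lexx/= le_min lexx/=.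
  by move: H; rewrite ge_min => /orP[]; lra.
move: gu; rewrite ub => -[_ [n [p [q [pq pqI]]]]].
apply: Qle.
have -> : eta = eta / 2 + eta / 2 by lra.
apply: lerD.
  rewrite /e -mulrA ger_pMr ?divr_gt0// mulrC ler_pdivrMr// mul1r; lra.
apply: ltW; apply: (Hdelta n p q).
- by move=> i; have [] := pq i (ltn_ord i).
- move=> i j _ _ [x []]; rewrite /= !in_itv/= => /andP[px xq] /andP[px' xq'].
  apply/val_inj => /=; case: (ltngtP i j) => // ij; exfalso.
    have := pqI _ _ ij (ltn_ord j); lra.
  have := pqI _ _ ij (ltn_ord i); lra.
apply: (sum_length_le oU mU).
- by move=> i; have [] := pq i (ltn_ord i).
- by move=> i; have [] := pq i (ltn_ord i).
- move=> i j _ _ [x []]; rewrite /= !in_itv/= => /andP[px xq] /andP[px' xq'].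
  apply/val_inj => /=; case: (ltngtP i j) => // ij; exfalso.
    have := pqI _ _ ij (ltn_ord j); lra.
  have := pqI _ _ ij (ltn_ord i); lra.
Qed.

(** * Lipschitz functions are derivable almost everywhere *)

Lemma lipschitz_near_continuous (R : realType) (g : R -> R) (K t : R) :
  0 <= K ->
  (forall p q, p <= q -> `|t - p| <= 1 -> `|t - q| <= 1 ->
     `|g q - g p| <= K * (q - p)) ->
  {for t, continuous g}.
Proof.
move=> K0 gK; apply/cvgrPdist_le => e e0.
have eK : 0 < e / (K + 1) by rewrite divr_gt0// ltr_wpDl.
have tt : `|t - t| <= 1 by rewrite subrr normr0.
near=> s.
have s1 : `|t - s| <= 1 by near: s; exact: cvgr_dist_le.
have : `|t - s| <= e / (K + 1) by near: s; exact: cvgr_dist_le.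
rewrite ler_pdivlMr ?ltr_wpDl// => ts; apply: le_trans ts.
apply: (@le_trans _ _ (K * `|t - s|)); last by rewrite mulrC ler_wpM2l// lerDl.
have [st|/ltW ts] := leP s t.
  by rewrite (@ger0_norm _ (t - s)) ?subr_ge0// gK.
by rewrite distrC [`|t - s|]distrC (@ger0_norm _ (s - t)) ?subr_ge0// gK.
Unshelve. all: by end_near.
Qed.

(** Both measures are infima of sums over countable covers by half-open intervals, and the
    [G]-length of an interval is at most [K] times its length. *)
Lemma lipschitz_stieltjes_null (R : realType) (G : cumulative R R) (K : R) :
  0 <= K -> (forall s t, s <= t -> G t - G s <= K * (t - s)) ->
  forall A, lebesgue_measure A = 0%E -> lebesgue_stieltjes_measure G A = 0%E.
Proof.
move=> K0 GK A A0; apply/eqP; rewrite eq_le; apply/andP; split; last first.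
  exact: mu_ext_ge0.
apply/lee_addgt0Pr => /= e e0; rewrite add0e.
have eK0 : 0 < e / (K + 1) by rewrite divr_gt0// ltr_wpDl.
have : (lebesgue_measure A < (e / (K + 1))%:E)%E by rewrite A0 lte_fin.
rewrite /lebesgue_measure /lebesgue_stieltjes_measure /measure_extension {1}/mu_ext.
move=> /ereal_inf_lt[_ [F [mF AF] <-] Fe].
apply: (@le_trans _ _ (\sum_(k <oo) wlength G (F k))%E).
  by apply: ereal_inf_lbound; exists F.
have wK k : (wlength G (F k) <= K%:E * wlength idfun (F k))%E.
  have /ocitvP[->|[[x y]/= xy ->]] : ocitv (F k) by exact: mF.
    by rewrite !wlength0 mule0.
  rewrite !wlength_itv/= !lte_fin xy -!EFinB -EFinM lee_fin.
  exact/GK/ltW.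
have wl0 k : (0 <= wlength idfun (F k))%E by exact: wlength_ge0.
apply: (@le_trans _ _ (\sum_(k <oo) (K%:E * wlength idfun (F k)))%E).
  by apply: lee_nneseries => // k _ _; exact: wlength_ge0.
rewrite nneseriesZl//.
apply: (@le_trans _ _ ((K + 1)%:E * \sum_(k <oo) wlength idfun (F k))%E).
  by rewrite lee_wpmul2r ?nneseries_ge0// lee_fin lerDl.
rewrite -lee_pdivlMl ?ltr_wpDl//.
by apply: ltW; rewrite -EFinM mulrC.
Qed.

(* g is the distribution function of its Lebesgue-Stieltjes measure, which has
   a density by Radon-Nikodym; Lebesgue differentiation applies to the density. *)
Lemma lipschitz_ndecr_ae_derivable_itv (R : realType) (g : R -> R) (K a b : R) :
  0 <= K -> (forall s t, s <= t -> 0 <= g t - g s <= K * (t - s)) -> a < b ->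
  {ae lebesgue_measure, forall x, a < x < b -> derivable g x 1}.
Proof.
move=> K0 gK ab.
have nd : nondecreasing g.
  by move=> s t st; rewrite -subr_ge0; have /andP[] := gK s t st.
have cg : continuous g.
  move=> x; apply: (lipschitz_near_continuous K0) => s t st _ _.
  by rewrite ger0_norm ?subr_ge0 ?nd//; have /andP[] := gK s t st.
pose G : cumulative R R := HB.pack g (@isCumulative.Build R _ R g nd (right_continuousW cg)).
pose nu : {measure set (measurableTypeR R) -> \bar R} := lebesgue_stieltjes_measure G.
have nuE s t : s <= t -> nu `]s, t]%classic = (g t - g s)%:E.
  move=> st; rewrite -(wlength_itv_bnd g false false st).
  exact: measurable_mu_extE (is_ocitv s t).
pose D : set (measurableTypeR R) := `]a, b]%classic.
have mD : measurable D by exact: measurable_itv.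
have Doo : (nu D < +oo)%E by rewrite nuE ?ltW// ltry.
(* Restricting to []a, b]] makes the measure finite, hence its density integrable on the whole
   line. *)
pose nuD : {finite_measure set (measurableTypeR R) -> \bar R} := mfrestr mD Doo.
have nulam : nuD `<<
    (lebesgue_measure : {sigma_finite_measure set (measurableTypeR R) -> \bar R}).
  apply/null_content_dominatesP => A mA A0.
  rewrite /nuD /= /mfrestr /mrestr /=.
  apply: (@lipschitz_stieltjes_null _ G K) => //.
    by move=> s t st; have /andP[] := gK s t st.
  apply: subset_measure0 A0 => //; exact: measurableI.
have [h [h0 hfin hint hE]] := radon_nikodym_sigma_finite nulam.
pose f := fine \o h.
have fE : EFin \o f = h by apply/funext => x; rewrite /f /= fineK.
have fint : lebesgue_measure.-integrable setT (EFin \o f) by rewrite fE.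
have fint1 y : lebesgue_measure.-integrable [set` Interval (BRight a) (BRight y)] (EFin \o f).
  by apply: integrableS fint => //; exact: measurable_itv.
have floc : locally_integrable setT f.
  by apply: open_integrable_locally => //; exact: openT.
pose F y := (\int[lebesgue_measure]_(t in [set` Interval (BRight a) (BRight y)]) f t).
have := FTC1 fint1 floc; rewrite -/F.
apply: filterS; first exact: (ae_filter_ringOfSetsType lebesgue_measure).
move=> x H /andP[ax xb].
have /H[dF _] : (BRight a < BRight x)%O by rewrite bnd_simp.
have dF' : derivable (fun t => F t + cst (g a) t) x 1.
  exact: (derivableD dF (derivable_cst (g a) x 1)).
(* Near a point of []a, b[] the primitive [F] of the density is [g] minus the constant [g a]. *)
apply: near_eq_derivable dF'.
near=> y.
have ay : a <= y by apply: ltW; near: y; exact: lt_nbhsr.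
have yb : y <= b by apply: ltW; near: y; exact: lt_nbhsl.
have -> : F y = fine (\int[lebesgue_measure]_(t in `]a, y]) (EFin \o f) t)%E by [].
rewrite fE -hE; last exact: measurable_itv.
have -> : nuD `]a, y]%classic = nu `]a, y]%classic.
  rewrite /nuD /= /mfrestr /mrestr /=; congr (nu _).
  apply/seteqP; split=> z /=; first by case.
  move=> zay; split=> //; move: zay; rewrite /D/= !in_itv/= => /andP[-> zy].
  exact: le_trans yb.
by rewrite nuE//= subrK.
Unshelve. all: by end_near.
Qed.

Lemma lipschitz_ae_derivable (R : realType) (g : R -> R) (K : R) :
  0 <= K -> (forall s t, s <= t -> `|g t - g s| <= K * (t - s)) ->
  {ae lebesgue_measure, forall x, derivable g x 1}.
Proof.
move=> K0 gK.
(* Adding [K * t] makes the function nondecreasing, with Lipschitz constant [K + K]. *)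
pose G t := g t + K * t.
have H n : {ae lebesgue_measure, forall x, - n.+1%:R < x < n.+1%:R -> derivable G x 1}.
  apply: (@lipschitz_ndecr_ae_derivable_itv _ G (K + K)).
  - exact: addr_ge0.
  - move=> s t st; have := gK s t st; rewrite ler_norml /G => /andP[h1 h2].
    apply/andP; split; lra.
  - by rewrite (@lt_trans _ _ 0)// oppr_lt0.
have : {ae lebesgue_measure, forall x, forall n : nat,
    - n.+1%:R < x < n.+1%:R -> derivable G x 1}.
  apply: negligibleS (negligible_bigcup H) => x /= /existsNP[n nH].
  by exists n.
apply: filterS; first exact: (ae_filter_ringOfSetsType lebesgue_measure).
move=> x Hx.
have dG : derivable G x 1.
  have [n xn] : exists n : nat, `|x| < n%:R.
    by exists (Num.bound `|x|); exact: archi_boundP.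
  apply: (Hx n); rewrite -ltr_norml (lt_trans xn)// ltr_nat//.
have -> : g = fun t => G t - K *: t.
  by apply/funext => t; rewrite /G /GRing.scale/= addrK.
have dK : derivable (fun t : R => K *: t) x 1.
  by apply: derivableZ; exact: derivable_id.
exact: (derivableB dG dK).
Qed.

(** * Derivatives of matrix-valued functions *)

(** The form used by the covering arguments: there is no quotient, hence no exclusion of [s = t],
    and the bounds on the two sides of [t] can be added. *)
Lemma is_derive_nearP (R : realType) (V : normedModType R) (x : R -> V) (t : R) v :
  is_derive t 1 x v <-> forall e, 0 < e ->
    \forall s \near t, `|x s - x t - (s - t) *: v| <= e * `|s - t|.
Proof.
have key (h : R) : h != 0 -> `|v - h^-1 *: (x (h *: 1 + t) - x t)|
    = `|h|^-1 * `|x (h + t) - x t - h *: v|.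
  move=> h0; rewrite -normfV -normrZ !scalerBr scalerA mulVf// scale1r.
  by rewrite [h *: 1]mulr1 distrC.
split=> [[dx dxE] e e0|H].
  have /cvgrPdist_le/(_ _ e0) := dx.
  rewrite near_withinE => /nbhs_ballP[r /= r0 Hr].
  apply/nbhs_ballP; exists r => // s /= st.
  have [->|st0] := eqVneq s t.
    by rewrite !subrr scale0r subr0 !normr0 mulr0.
  have h0 : s - t != 0 by rewrite subr_eq0.
  have := Hr (s - t); rewrite /ball/= sub0r normrN distrC => /(_ st h0).
  rewrite -[lim _]/('D_1 x t) dxE key// subrK => Hle.
  by rewrite mulrC [`|t - s|]distrC -ler_pdivrMl ?normr_gt0.
have cv : h^-1 *: (x (h *: 1 + t) - x t) @[h --> 0^'] --> v.
  apply/cvgrPdist_le => e e0.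
  have /nbhs_ballP[r /= r0 Hr] := H e e0.
  rewrite near_withinE; apply/nbhs_ballP; exists r => //= h.
  rewrite /ball/= sub0r normrN => hr h0.
  rewrite key// ler_pdivrMl ?normr_gt0// mulrC.
  have := Hr (h + t); rewrite /= addrK; apply.
  by rewrite /ball/= opprD addrCA subrr addr0 normrN.
split; last exact: cvg_lim cv.
by apply/cvg_ex; exists v.
Qed.

Lemma mx_norm_le (R : realType) m n (M : 'M[R]_(m, n)) c :
  0 <= c -> (forall i j, `|M i j| <= c) -> `|M| <= c.
Proof.
move=> c0 H; rewrite [leLHS]/Num.Def.normr/= mx_normrE.
by apply: bigmax_le => // -[i j] _; exact: H.
Qed.

Lemma mx_coord_le (R : realType) m n (M : 'M[R]_(m, n)) i j : `|M i j| <= `|M|.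
Proof.
rewrite [leRHS]/Num.Def.normr/= mx_normrE.
exact: (le_bigmax _ (fun ij => `|M ij.1 ij.2|) (i, j)).
Qed.

Lemma mulmx_norm_le (R : realType) m n p (B : 'M[R]_(m, n)) (C : 'M[R]_(n, p)) :
  `|B *m C| <= n%:R * `|B| * `|C|.
Proof.
apply: mx_norm_le => [|i j]; first by rewrite !mulr_ge0.
rewrite mxE (le_trans (ler_norm_sum _ _ _))//.
apply: (@le_trans _ _ (\sum_(k < n) `|B| * `|C|)).
  by apply: ler_sum => k _; rewrite normrM ler_pM ?mx_coord_le.
by rewrite sumr_const card_ord -mulrA mulr_natl.
Qed.

Lemma is_derive_mxP (R : realType) m n (x : R -> 'M[R]_(m, n)) (t : R) v :
  is_derive t 1 x v <-> forall i j, is_derive t 1 (fun s => x s i j) (v i j).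
Proof.
split=> [H i j|H].
  apply/is_derive_nearP => e e0; have := (is_derive_nearP x t v).1 H e e0.
  apply: filterS => s; apply: le_trans.
  have := mx_coord_le (x s - x t - (s - t) *: v) i j.
  by rewrite !mxE.
apply/is_derive_nearP => e e0.
pose P (ij : 'I_m * 'I_n) (s : R) :=
  `|x s ij.1 ij.2 - x t ij.1 ij.2 - (s - t) * v ij.1 ij.2| <= e * `|s - t|.
have : \forall s \near t, forall ij, P ij s.
  apply: (@filter_forall R ('I_m * 'I_n)%type P (nbhs t) _) => ij.
  exact: ((is_derive_nearP _ t _).1 (H ij.1 ij.2) e e0).
apply: filterS => s Hs; apply: mx_norm_le => [|i j]; first by rewrite mulr_ge0// ltW.
by rewrite !mxE; exact: Hs (i, j).
Qed.

(** * Primitives *)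

Lemma bounded_measurable_primitive (R : realType) (a : R) (b : R -> R) :
  measurable_fun `[a, +oo[ b ->
  (forall T : R, exists C : R, forall t : R, a <= t <= T -> `|b t| <= C) ->
  exists G : R -> R,
    [/\ G a = 0,
        forall s t C : R, a <= s -> s <= t ->
          (forall u, s <= u <= t -> `|b u| <= C) -> `|G t - G s| <= C * (t - s) &
        {ae lebesgue_measure, forall t, a <= t -> is_derive t 1 G (b t)}].
Proof.
move=> mb bb.
(* Extension by zero, bounded on every half-line to the left of some [T]. *)
pose f := b \_ `[a, +oo[%classic.
have mf : measurable_fun setT f.
  by apply/(measurable_restrictT _ _).1 => //; exact: measurable_itv.
have fb t : a <= t -> f t = b t.
  by move=> at_; rewrite /f patchE mem_set//= in_itv/= andbT.
have fbd T : exists2 C, 0 <= C & forall t, t <= T -> `|f t| <= C.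
  have [C HC] := bb T; exists `|C| => // t tT; rewrite /f patchE.
  case: ifPn => [|_]; last by rewrite normr0.
  rewrite inE/= in_itv/= andbT => at_.
  by apply: le_trans (ler_norm _); apply: HC; rewrite at_ tT.
have fint (i : interval R) T : (lebesgue_measure [set` i] < +oo)%E ->
    (forall t, t \in i -> t <= T) -> lebesgue_measure.-integrable [set` i] (EFin \o f).
  move=> ioo iT; have [C C0 HC] := fbd T.
  apply: measurable_bounded_integrable => //.
  - exact: measurable_funTS.
  - exists C; split; first exact: num_real.
    by move=> M CM x /= xi; rewrite (le_trans (HC _ (iT x xi)))// ltW.
have itvoo (x y : R) (p q : bool) :
    (lebesgue_measure [set` Interval (BSide p x) (BSide q y)] < +oo)%E.
  by rewrite lebesgue_measure_itv/=; case: ifP => _; rewrite ?ltry// -EFinB ltry.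
have fint1 p y : lebesgue_measure.-integrable [set` Interval (BSide p a) (BRight y)] (EFin \o f).
  by apply: (fint _ y) => // t; rewrite in_itv/= => /andP[].
have floc : locally_integrable setT f.
  split=> //; first exact: openT.
  move=> K _ cK; have mK := compact_measurable cK.
  have [M [_ HM]] := compact_bounded cK.
  have [C C0 HC] := fbd (M + 1).
  apply: (@le_lt_trans _ _ (\int[lebesgue_measure]_(x in K) (cst C%:E) x)%E).
    apply: ge0_le_integral => //.
    - apply/measurable_EFinP; apply: measurableT_comp => //.
      exact: measurable_funTS.
    - move=> x Kx; rewrite lee_fin; apply: HC.
      apply: le_trans (ler_norm _) _; apply: HM => //; by rewrite ltrDl.
  by rewrite integral_cst// lte_mul_pinfty// compact_finite_measure.
pose G y := (\int[lebesgue_measure]_(t in [set` Interval (BRight a) (BRight y)]) f t).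
exists G; split.
- by rewrite /G set_itv_ge ?bnd_simp ?ltxx// Rintegral_set0.
- move=> s t C as_ st HC.
  have C0 : 0 <= C.
    by apply: le_trans (normr_ge0 (b s)) _; apply: HC; rewrite lexx st.
  rewrite /G Rintegral_itvB//.
  have sti : lebesgue_measure.-integrable [set` Interval (BRight s) (BRight t)] (EFin \o f).
    by apply: (fint _ t) => // u; rewrite in_itv/= => /andP[].
  apply: le_trans (le_normr_Rintegral _ sti) _ => //.
  have -> : C * (t - s) = \int[lebesgue_measure]_(x in [set` Interval (BRight s) (BRight t)]) C.
    rewrite Rintegral_cst//; congr (_ * _).
    have mst : lebesgue_measure `]s, t]%classic = (t - s)%:E.
      rewrite lebesgue_measure_itv/= lte_fin; case: ltP => // ts.
      by have -> : s = t; [apply/le_anti; rewrite st|rewrite subrr].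
    by rewrite -[LHS]/(fine (t - s)%:E) -mst.
  apply: le_Rintegral => //.
  + exact: integrable_norm.
  + apply: measurable_bounded_integrable => //; first exact: itvoo.
    by exists `|C|; split; [exact: num_real|move=> M CM x _; exact: ltW].
  + move=> x; rewrite /= in_itv/= => /andP[sx xt].
    have asx : a <= x by apply: le_trans as_ _; exact: ltW.
    by rewrite fb//; apply: HC; rewrite xt ltW.
- have := FTC1 (fint1 false) floc; rewrite -/G => H.
  (* The integral is differentiated only strictly to the right of [a]. *)
  have Ha : {ae lebesgue_measure, forall t : R, t != a}.
    exists [set a]; split => //; first exact: lebesgue_measure_set1.
    by move=> t /= /negP; rewrite negbK => /eqP.
  move: H Ha; apply: filterS2; first exact: (ae_filter_ringOfSetsType lebesgue_measure).
  move=> t H ta at_.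
  have /H[dG GE] : (BRight a < BRight t)%O by rewrite bnd_simp lt_neqAle eq_sym ta.
  by split=> //; rewrite -derive1E GE fb.
Qed.

(** * Mean values *)

Lemma convex_setP (R : realType) d (A : set 'M[R]_d) :
  convex_set (A : set (convex_lmodType 'M[R]_d)) ->
  forall B C (p : R), A B -> A C -> 0 <= p <= 1 -> A (p *: B + (1 - p) *: C).
Proof.
move=> cA B C p AB AC /andP[p0 p1].
have [q ->] : exists q : {i01 R}, p = q%:num.
  have p01 : Itv.spec (@Itv.num_sem R) (Itv.Real `[0%Z, 1%Z]) p.
    by rewrite /Itv.spec/=/Itv.num_sem/= num_real/= in_itv/= p0 p1.
  by exists (Itv.mk p01).
apply: set_mem; exact: (cA B C q (mem_set AB) (mem_set AC)).
Qed.

Lemma near_ballP (R : realType) (t : R) (P : R -> Prop) :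
  (\forall s \near t, P s) -> exists2 r : R, 0 < r & forall s, `|s - t| < r -> P s.
Proof.
move=> /nbhs_ballP[r/= r0 H]; exists r => // s st; apply: H.
by rewrite /ball/= distrC.
Qed.

Lemma ac_size_lipschitz (R : realType) (a b : R) (w : R -> R -> R) (K : R) :
  0 <= K ->
  (forall s t, a <= s -> s <= t -> t <= b -> w s t <= K * (t - s)) -> ac_size a b w.
Proof.
move=> K0 wK e e0; exists (e / (K + 1)); first by rewrite divr_gt0// ltr_wpDl.
move=> n u v uv _ sm.
apply: (@le_lt_trans _ _ (K * \sum_(i < n) (v i - u i))).
  by rewrite mulr_sumr ler_sum// => i _; have [? ? ?] := uv i; exact: wK.
apply: (@le_lt_trans _ _ ((K + 1) * \sum_(i < n) (v i - u i))).
  rewrite ler_wpM2r ?lerDl// sumr_ge0// => i _; have [_ ? _] := uv i.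
  by rewrite subr_ge0.
by rewrite mulrC -ltr_pdivlMr// ltr_wpDl.
Qed.

(** The property [Q] of the covering argument is the inequality with an error term. Where no
    derivative is known, the whole increment of [x] counts as error, which is allowed because [phi]
    is monotone; elsewhere the two derivatives are compared. *)
Lemma ac_mean_value (R : realType) (V : normedModType R) (x v : R -> V)
    (phi dphi : R -> R) (a b : R) (N : set R) :
  a <= b -> ac_size a b (fun s t => `|x t - x s|) ->
  lebesgue_measure.-negligible N ->
  (forall s t, a <= s -> s <= t -> t <= b -> phi s <= phi t) ->
  (forall t, a <= t <= b -> is_derive t 1 phi (dphi t)) ->
  (forall t, a <= t <= b -> ~ N t -> is_derive t 1 x (v t) /\ `|v t| <= dphi t) ->
  `|x b - x a| <= phi b - phi a.
Proof.
move=> ab ACx N0 nd dp dx; apply/ler_addgt0Pr => e e0.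
pose Q s t e := `|x t - x s| <= phi t - phi s + e.
apply: (@ac_cousin _ a b _ N Q ab ACx N0 _ _ _ _ _ e e0); rewrite /Q.
- by rewrite !subrr normr0 addr0.
- move=> s t u e1 e2 _ _ _ _ H1 H2.
  have := ler_normD (x u - x t) (x t - x s); rewrite subrKA; lra.
- by move=> s t e1 e2 e12 H; apply: (le_trans H); rewrite lerD2l.
- by move=> s t as_ st tb; rewrite lerDr subr_ge0 nd.
move=> t tab Nt e1 e10; have [dxt vt] := dx t tab Nt; have dpt := dp t tab.
(* Half of the slope [e1] absorbs the error in [x], the other half that in [phi]. *)
have e20 : 0 < e1 / 2 by rewrite divr_gt0.
have [r1 r10 H1] := near_ballP ((is_derive_nearP _ _ _).1 dxt _ e20).
have [r2 r20 H2] := near_ballP ((is_derive_nearP _ _ _).1 dpt _ e20).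
exists (Num.min r1 r2); first by rewrite lt_min r10 r20.
move=> s u as_ st tu ub; rewrite lt_min => /andP[su1 su2].
have D (y : R) : s <= y <= u -> `|y - t| <= u - s.
  by move=> /andP[? ?]; rewrite ler_norml; apply/andP; split; lra.
have Ds := D s; have Du := D u.
have su : s <= u by exact: le_trans tu.
have H1s := H1 s (le_lt_trans (Ds _) su1); have H1u := H1 u (le_lt_trans (Du _) su1).
have H2s := H2 s (le_lt_trans (Ds _) su2); have H2u := H2 u (le_lt_trans (Du _) su2).
move: {Ds Du D} H1s H1u H2s H2u.
rewrite !lexx su => /(_ isT) A1 /(_ isT) A2 /(_ isT) A3 /(_ isT) A4.
have st' : `|s - t| = t - s by rewrite distrC ger0_norm// subr_ge0.
have ut' : `|u - t| = u - t by rewrite ger0_norm// subr_ge0.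
rewrite st' in A1 A3; rewrite ut' in A2 A4.
have B1 : `|x s - x t| <= dphi t * (t - s) + e1 / 2 * (t - s).
  have := ler_normD (x s - x t - (s - t) *: v t) ((s - t) *: v t).
  rewrite subrK normrZ st' => /le_trans; apply; rewrite addrC lerD//.
  by rewrite mulrC ler_wpM2r// subr_ge0.
have B2 : `|x u - x t| <= dphi t * (u - t) + e1 / 2 * (u - t).
  have := ler_normD (x u - x t - (u - t) *: v t) ((u - t) *: v t).
  rewrite subrK normrZ ut' => /le_trans; apply; rewrite addrC lerD//.
  by rewrite mulrC ler_wpM2r// subr_ge0.
have := ler_normD (x u - x t) (x t - x s); rewrite subrKA [`|x t - x s|]distrC => B3.
move: A3 A4; rewrite !ler_norml /GRing.scale/= => /andP[A3 A3'] /andP[A4 A4'].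
nra.
Qed.

(** The covering argument is applied to the distance from an increment of [beta] to the multiples
    [(t - s) *: M] with [M] in [A]. Convexity makes these approximations additive, the average on
    [[s, u]] being a convex combination of those on [[s, t]] and [[t, u]]; closedness removes the
    error at the end. *)
Lemma ac_average_in (R : realType) d (A : set 'M[R]_d) (beta B : R -> 'M[R]_d)
    (a b : R) (N : set R) (K : R) :
  a < b -> convex_set (A : set (convex_lmodType 'M[R]_d)) -> closed A ->
  (forall M, A M -> `|M| <= K) -> 0 <= K ->
  lebesgue_measure.-negligible N ->
  (forall s t, a <= s -> s <= t -> t <= b -> `|beta t - beta s| <= K * (t - s)) ->
  (forall t, a <= t <= b -> A (B t)) ->
  (forall t, a <= t <= b -> ~ N t -> is_derive t 1 beta (B t)) ->
  A ((b - a)^-1 *: (beta b - beta a)).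
Proof.
move=> ab cA clA bA K0 N0 bK AB db.
have ba0 : 0 < b - a by rewrite subr_gt0.
have Aa : A (B a) by apply: AB; rewrite lexx ltW.
pose Q s t e := exists2 M, A M & `|beta t - beta s - (t - s) *: M| <= e.
pose w s t := `|beta t - beta s| + K * (t - s).
have ACw : ac_size a b w.
  apply: (@ac_size_lipschitz _ _ _ _ (K + K)); first exact: addr_ge0.
  by move=> s t as_ st tb; rewrite /w mulrDl lerD2r bK.
have H e : 0 < e -> Q a b e.
  apply: (@ac_cousin _ a b _ N Q (ltW ab) ACw N0); rewrite /Q.
  - by exists (B a) => //; rewrite !subrr scale0r subr0 normr0.
  - move=> s t u e1 e2 _ st tu _ [M1 AM1 H1] [M2 AM2 H2].
    (* The weight [(t - s) / (u - s)] makes no sense on a degenerate interval. *)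
    have [su|su] := eqVneq s u.
      exists M1 => //; have tE : t = s by apply/le_anti; rewrite su tu -su st.
      rewrite -su subrr subrr scale0r subr0 normr0.
      by rewrite addr_ge0// (le_trans (normr_ge0 _) H1, le_trans (normr_ge0 _) H2).
    have us0 : 0 < u - s by rewrite subr_gt0 lt_neqAle su (le_trans st).
    exists ((t - s) / (u - s) *: M1 + (1 - (t - s) / (u - s)) *: M2).
      apply: convex_setP => //; rewrite ler_pdivrMr// mul1r lerD2r tu andbT.
      by rewrite divr_ge0 ?(ltW us0)// subr_ge0.
    rewrite scalerDr !scalerA mulrBr mulr1 mulrCA divff ?gt_eqF// mulr1.
    have -> : u - s - (t - s) = u - t by ring.
    have -> : beta u - beta s - ((t - s) *: M1 + (u - t) *: M2) =
       (beta t - beta s - (t - s) *: M1) + (beta u - beta t - (u - t) *: M2).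
      by apply/matrixP => i j; rewrite !mxE; ring.
    by apply: (le_trans (ler_normD _ _)); exact: lerD.
  - by move=> s t e1 e2 e12 [M AM H]; exists M => //; exact: le_trans e12.
  (* Where no derivative is known, [B a] serves as an arbitrary element of [A]; [w] is the resulting
     cost. *)
  - move=> s t as_ st tb; exists (B a) => //.
    rewrite (le_trans (ler_normB _ _))// lerD2l normrZ ger0_norm ?subr_ge0//.
    by rewrite mulrC ler_wpM2r ?subr_ge0// bA.
  - move=> t tab Nt e1 e10; have dbt := db t tab Nt.
    have [r r0 Hr] := near_ballP ((is_derive_nearP _ _ _).1 dbt _ e10).
    exists r => // s u as_ st tu ub su.
    exists (B t); first exact: AB.
    have Hs := Hr s _; have Hu := Hr u _.
    have st' : `|s - t| = t - s by rewrite distrC ger0_norm// subr_ge0.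
    have ut' : `|u - t| = u - t by rewrite ger0_norm// subr_ge0.
    move: Hs Hu; rewrite st' ut' => Hs Hu.
    have {}Hs := Hs _; have := Hs _; rewrite (le_lt_trans _ su) ?lerD2r// => /(_ isT) Cs.
    move: Hu; rewrite (le_lt_trans _ su) ?lerD2l ?lerN2// => /(_ isT) Cu.
    have -> : beta u - beta s - (u - s) *: B t =
       (beta u - beta t - (u - t) *: B t) - (beta s - beta t - (s - t) *: B t).
      by apply/matrixP => i j; rewrite !mxE; ring.
    apply: (le_trans (ler_normB _ _)).
    have -> : e1 * (u - s) = e1 * (u - t) + e1 * (t - s) by ring.
    exact: lerD.
have ba' : forall e, 0 < e -> exists2 M, A M & `|(b - a)^-1 *: (beta b - beta a) - M| <= e.
  move=> e e0; have [M AM HM] := H _ (mulr_gt0 e0 ba0).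
  exists M => //.
  have -> : (b - a)^-1 *: (beta b - beta a) - M =
      (b - a)^-1 *: (beta b - beta a - (b - a) *: M).
    by rewrite [RHS]scalerBr scalerA mulVf ?gt_eqF// scale1r.
  by rewrite normrZ normfV (ger0_norm (ltW ba0)) ler_pdivrMl// mulrC.
apply: clA => U /nbhs_ballP[e/= e0 eU].
have e20 : 0 < e / 2 by rewrite divr_gt0.
have [M AM HM] := ba' _ e20; exists M; split=> //; apply: eU.
rewrite mx_norm_ball /ball_/=; apply: (le_lt_trans HM).
by rewrite ltr_pdivrMr// ltr_pMr// ltr1n.
Qed.

(** * Derivative-free description of solutions *)

Lemma is_derive_mulr (R : realType) (c t : R) : is_derive t 1 (fun u => c * u) c.
Proof.
apply/is_derive_nearP => e e0; near=> u.
have -> : c * u - c * t - (u - t) *: c = 0 by rewrite /GRing.scale/=; ring.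
by rewrite normr0 mulr_ge0// ltW.
Unshelve. all: by end_near.
Qed.

(** The entrywise maximum norm is submultiplicative only up to the factor [d], so the bound on the
    action on vectors is recorded along with the bound on the matrices. *)
Definition size_bound (R : realType) d (A : set 'M[R]_d) (K : R) :=
  0 <= K /\ forall M, A M -> `|M| <= K /\ forall v : 'cV[R]_d, `|M *m v| <= K * `|v|.

Lemma compact_size_bound (R : realType) d (A : set 'M[R]_d) :
  compact A -> exists K, size_bound A K.
Proof.
move=> /compact_bounded[C [_ HC]].
pose c := `|C| + 1.
have Cc : C < c by rewrite /c ltr_pwDr// ler_norm.
have c0 : 0 <= c by rewrite addr_ge0.
exists (c + d%:R * c); split; first by rewrite addr_ge0// mulr_ge0.
move=> M AM; have Mc : `|M| <= c by exact: HC AM.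
split=> [|v]; first by rewrite (le_trans Mc)// lerDl mulr_ge0.
apply: (le_trans (mulmx_norm_le _ _)); rewrite ler_wpM2r//.
apply: (@le_trans _ _ (d%:R * c)); first by rewrite ler_wpM2l.
by rewrite lerDr.
Qed.

(* beta is a primitive of the switching law.  The explicit constants make the
   condition stable under concatenation and under pointwise limits. *)
Definition integral_solution (R : realType) d (K m : R) (A : set 'M[R]_d)
    (D : set R) (x : R -> 'cV[R]_d) :=
  (forall t, D t -> `|x t| <= m) /\
  exists beta : R -> 'M[R]_d,
    (forall s t, D s -> D t -> s < t -> A ((t - s)^-1 *: (beta t - beta s))) /\
    forall s t, D s -> D t -> s <= t ->
      `|x t - x s| <= K * m * (t - s) /\
      `|x t - x s - (beta t - beta s) *m x s| <= K ^+ 2 * m * (t - s) ^+ 2.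

Lemma is_derive_mulmxr (R : realType) m n p (beta : R -> 'M[R]_(m, n)) (t : R) B
    (c : 'M[R]_(n, p)) :
  is_derive t 1 beta B -> is_derive t 1 (fun s => beta s *m c) (B *m c).
Proof.
move=> /is_derive_nearP H; apply/is_derive_nearP => e e0.
have k0 : 0 < n%:R * `|c| + 1 by rewrite ltr_wpDl// mulr_ge0.
apply: filterS (H _ (divr_gt0 e0 k0)) => s Hs.
rewrite -mulmxBl scalemxAl -mulmxBl.
apply: (le_trans (mulmx_norm_le _ _)).
rewrite mulrAC.
apply: (@le_trans _ _ ((n%:R * `|c| + 1) * (e / (n%:R * `|c| + 1) * `|s - t|))).
  by apply: ler_pM; rewrite ?mulr_ge0 ?lerDl.
by rewrite mulrA [X in X * _]mulrC divfK ?gt_eqF.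
Qed.

Lemma ler_control_increment (R : realType) d (A : set 'M[R]_d) (K : R) (beta : R -> 'M[R]_d) s t :
  size_bound A K -> s <= t ->
  (s < t -> A ((t - s)^-1 *: (beta t - beta s))) ->
  `|beta t - beta s| <= K * (t - s) /\
  forall v : 'cV[R]_d, `|(beta t - beta s) *m v| <= K * (t - s) * `|v|.
Proof.
move=> [K0 AK]; rewrite le_eqVlt => /predU1P[-> _|st /(_ st)/AK[H1 H2]].
  by split=> [|v]; rewrite !subrr ?mul0mx normr0 !mulr0// mul0r.
have ts0 : 0 < t - s by rewrite subr_gt0.
have E : beta t - beta s = (t - s) *: ((t - s)^-1 *: (beta t - beta s)).
  by rewrite scalerA divff ?gt_eqF// scale1r.
split=> [|v]; rewrite E.
  by rewrite normrZ (ger0_norm (ltW ts0)) mulrC ler_wpM2r// ltW.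
by rewrite -scalemxAl normrZ (ger0_norm (ltW ts0)) [leRHS]mulrAC [leRHS]mulrC ler_wpM2l// ltW.
Qed.

(** [beta] is the entrywise primitive of the law, and its averages lie in [A] by [ac_average_in].
    Bounding the derivative of [x] by [K * m] gives the first estimate; feeding it into the
    derivative of the error gives the second, whence [K ^+ 2 * m]. The general [D] covers
    trajectories as well as stems. *)
Lemma solution_integral (R : realType) d (K m a : R) (A : set 'M[R]_d)
    (D : set R) (x : R -> 'cV[R]_d) :
  size_bound A K -> convex_set (A : set (convex_lmodType 'M[R]_d)) -> closed A ->
  measurable D -> solution A D x -> `[a, +oo[ `<=` D -> (forall t, a <= t -> `|x t| <= m) ->
  integral_solution K m A `[a, +oo[ x.
Proof.
move=> sb cA clA mD [acx [B [AB mB dx]]] aD xm.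
have [K0 AK] := sb.
have Dt t : a <= t -> D t by move=> at_; apply: aD; rewrite /= in_itv/= at_.
have m0 : 0 <= m by apply: le_trans (xm a (lexx a)).
have /choice[G HG] (ij : 'I_d * 'I_d) : exists G : R -> R,
    (forall s t : R, a <= s -> s <= t -> `|G t - G s| <= K * (t - s)) /\
    {ae lebesgue_measure, forall t, a <= t -> is_derive t 1 G (B t ij.1 ij.2)}.
  have Bij t : a <= t -> `|B t ij.1 ij.2| <= K.
    move=> at_; apply: (le_trans (mx_coord_le _ _ _)).
    by have [] := AK _ (AB t (Dt t at_)).
  have [||G [_ GK dG]] := @bounded_measurable_primitive R a (fun t => B t ij.1 ij.2).
  - exact: (measurable_funS mD aD (mB ij.1 ij.2)).
  - by move=> T; exists K => t /andP[+ _]; exact: Bij.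
  exists G; split=> // s t as_ st; apply: GK => // u /andP[su _].
  by apply: Bij; exact: le_trans su.
pose beta t : 'M[R]_d := \matrix_(i, j) G (i, j) t.
have betaK s t : a <= s -> s <= t -> `|beta t - beta s| <= K * (t - s).
  move=> as_ st; apply: mx_norm_le => [|i j]; first by rewrite mulr_ge0// subr_ge0.
  by rewrite !mxE; have [H _] := HG (i, j); exact: H.
have [N N0 HN] : exists2 N, lebesgue_measure.-negligible N & forall t, a <= t -> ~ N t ->
    is_derive t 1 x (B t *m x t) /\ is_derive t 1 beta (B t).
  have : {ae lebesgue_measure, forall t, forall ij : 'I_d * 'I_d,
      a <= t -> is_derive t 1 (G ij) (B t ij.1 ij.2)}.
    apply: (@filter_forall R ('I_d * 'I_d)%type
      (fun ij t => a <= t -> is_derive t 1 (G ij) (B t ij.1 ij.2)) _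
      (ae_filter_ringOfSetsType lebesgue_measure)) => ij.
    by have [_] := HG ij.
  have FF := ae_filter_ringOfSetsType (@lebesgue_measure R).
  move=> /(filterI dx) H; eexists; first exact: H.
  move=> t at_ /contrapT[/(_ (Dt t at_)) H1 H2]; split=> //.
  by apply/is_derive_mxP => i j; under eq_fun do rewrite mxE; exact: (H2 (i, j)).
split; first by move=> t; rewrite /= in_itv/= andbT; exact: xm.
exists beta; split.
  move=> s t; rewrite /= !in_itv/= !andbT => as_ at_ st.
  apply: (@ac_average_in R d A beta B s t N K) => //.
  - by move=> M AM; have [] := AK _ AM.
  - by move=> u v su uv vt; apply: betaK => //; exact: le_trans su.
  - by move=> u /andP[su _]; apply: AB; apply: Dt; exact: le_trans su.
  - by move=> u /andP[su _] Nu; have [] := HN u (le_trans as_ su) Nu.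
have xK s t : a <= s -> s <= t -> `|x t - x s| <= K * m * (t - s).
  move=> as_ st.
  have -> : K * m * (t - s) = (fun u => K * m * u) t - (fun u => K * m * u) s.
    by rewrite /= mulrBr.
  apply: (@ac_mean_value _ _ x (fun u => B u *m x u) _ (fun=> K * m) s t N) => //.
  - apply: acx => // u; rewrite /= in_itv/= => /andP[su _]; apply: Dt.
    exact: le_trans su.
  - by move=> u v _ uv _; rewrite ler_wpM2l// mulr_ge0.
  - by move=> u _; exact: is_derive_mulr.
  - move=> u /andP[su _] Nu; have au := le_trans as_ su.
    have [? _] := HN u au Nu; split=> //.
    have [_ H] := AK _ (AB u (Dt u au)).
    by apply: (le_trans (H _)); rewrite ler_wpM2l// xm.
move=> s t; rewrite /= !in_itv/= !andbT => as_ at_ st; split; first exact: xK.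
have c0 : 0 <= K ^+ 2 * m * (t - s) by rewrite !mulr_ge0 ?subr_ge0.
(* The increment of [y] is the error to be bounded; its derivative [B u *m (x u - x s)] has norm at
   most [K * (K * m * (t - s))]. *)
pose y u := x u - beta u *m x s.
have -> : x t - x s - (beta t - beta s) *m x s = y t - y s.
  by rewrite /y mulmxBl; apply/matrixP => i j; rewrite !mxE; ring.
have -> : K ^+ 2 * m * (t - s) ^+ 2 =
   (fun u => K ^+ 2 * m * (t - s) * u) t - (fun u => K ^+ 2 * m * (t - s) * u) s.
  by rewrite /=; ring.
apply: (@ac_mean_value _ _ y (fun u => B u *m x u - B u *m x s) _
  (fun=> K ^+ 2 * m * (t - s)) s t N) => //.
- apply: (@ac_size_lipschitz _ _ _ _ (K * m + d%:R * K * m)).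
    by rewrite addr_ge0// !mulr_ge0.
  move=> u v su uv vt; rewrite /y.
  have -> : x v - beta v *m x s - (x u - beta u *m x s) =
      (x v - x u) - (beta v - beta u) *m x s.
    by rewrite mulmxBl; apply/matrixP => i j; rewrite !mxE; ring.
  have au := le_trans as_ su.
  rewrite mulrDl (le_trans (ler_normB _ _))// lerD ?xK//.
  apply: (le_trans (mulmx_norm_le _ _)).
  apply: (@le_trans _ _ (d%:R * (K * (v - u)) * m)); last by rewrite -!mulrA [m * _]mulrC.
  by apply: ler_pM; rewrite ?mulr_ge0 ?xm// ler_wpM2l// betaK.
- by move=> u v _ uv _; rewrite ler_wpM2l.
- by move=> u _; exact: is_derive_mulr.
- move=> u /andP[su ut] Nu; have au := le_trans as_ su.
  have [dxu dbu] := HN u au Nu; split.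
    by apply: is_deriveB => //; exact: is_derive_mulmxr.
  have [_ H] := AK _ (AB u (Dt u au)).
  rewrite -mulmxBr (le_trans (H _))// expr2 -!mulrA ler_wpM2l//.
  apply: (le_trans (xK _ _ as_ su)).
  by rewrite -mulrA ler_wpM2l// ler_wpM2l// lerD2r.
Qed.

(** * From the derivative-free condition back to the differential equation *)

Lemma abs_continuous_lipschitz (R : realType) d (D : set R) (x : R -> 'cV[R]_d) (L : R) :
  0 <= L -> (forall s t, D s -> D t -> s <= t -> `|x t - x s| <= L * (t - s)) ->
  abs_continuous D x.
Proof.
move=> L0 H a b ab abD.
change (ac_size a b (fun s t => `|x t - x s|)).
apply: ac_size_lipschitz L0 _ => s t as_ st tb.
apply: H => //; apply: abD; rewrite /= in_itv/=.
  by rewrite as_ (le_trans st).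
by rewrite tb (le_trans as_).
Qed.

(** Off [N] the derivative is the pointwise limit of the difference quotients with step
    [n.+1%:R^-1], which are continuous functions. *)
Lemma measurable_derive_off_null (R : realType) (g : R -> R) (N : set R) (c : R) :
  measurable N -> continuous g -> (forall t, ~ N t -> derivable g t 1) ->
  measurable_fun setT (fun t => if t \in N then c else 'D_1 g t).
Proof.
move=> mN cg dg.
apply: measurable_fun_if => //.
- by apply: (measurable_fun_bool true); rewrite setTI preimage_mem_true.
- rewrite setTI preimage_mem_false.
  apply: (@measurable_fun_cvg _ _ _ _
    (fun (n : nat) (t : R) => n.+1%:R * (g (t + n.+1%:R^-1) - g t))).
  + move=> n; apply: measurable_funTS; apply: continuous_measurable_fun.
    have cgs : continuous (fun s : R => g (s + n.+1%:R^-1)).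
      move=> s; have cs : s + n.+1%:R^-1 @[s --> s] --> s + n.+1%:R^-1.
        by apply: cvgD; [exact: cvg_id|exact: cvg_cst].
      exact: (cvg_comp _ _ cs (cg _)).
    move=> t; apply: cvgM; first exact: cvg_cst.
    by apply: cvgB; [exact: cgs|exact: cg].
  + move=> t Nt.
    have /is_derive_nearP H : is_derive t 1 g ('D_1 g t).
      exact: (@DeriveDef _ _ _ _ _ _ _ (dg t Nt)).
    apply/cvgrPdist_le => e e0; have [r r0 Hr] := near_ballP (H e e0).
    near=> n.
    have nr : n.+1%:R^-1 < r by near: n; exact: near_infty_natSinv_lt (PosNum r0).
    have n0 : 0 < n.+1%:R :> R by [].
    have := Hr (t + n.+1%:R^-1); rewrite addrAC subrr add0r ger0_norm ?invr_ge0// => /(_ nr).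
    rewrite /GRing.scale/= => Hn; rewrite distrC.
    have -> : n.+1%:R * (g (t + n.+1%:R^-1) - g t) - 'D_1 g t =
      n.+1%:R * (g (t + n.+1%:R^-1) - g t - n.+1%:R^-1 * 'D_1 g t).
      by rewrite [RHS]mulrBr mulrA divff ?gt_eqF// mul1r.
    by rewrite normrM ger0_norm// mulrC -ler_pdivlMr.
Unshelve. all: by end_near.
Qed.

(** [r] is a nondecreasing 1-Lipschitz retraction of the line onto [D], so that [beta \o r] is
    Lipschitz on the whole line and differentiable almost everywhere; its derivative is the law. The
    null set [E] contains the points of [D] near which [D] is not all of the line, where [x] has no
    controlled two-sided derivative. *)
Lemma integral_solution_solution (R : realType) d (K m : R) (A : set 'M[R]_d)
    (D E : set R) (r : R -> R) (x : R -> 'cV[R]_d) :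
  size_bound A K -> A !=set0 -> closed A -> 
  (forall t, D (r t)) -> (forall t, D t -> r t = t) ->
  (forall s t, s <= t -> r s <= r t <= r s + (t - s)) ->
  lebesgue_measure.-negligible E -> (forall t, D t -> ~ E t -> \forall s \near t, D s) ->
  integral_solution K m A D x -> solution A D x.
Proof.
move=> sb [B0 AB0] clA rD rid r1 E0 Dnear [xm [beta [bA bx]]].
have [K0 AK] := sb.
have m0 : 0 <= m by exact: le_trans (xm _ (rD 0)).
split.
  apply: (@abs_continuous_lipschitz _ _ _ _ (K * m)); first by rewrite mulr_ge0.
  by move=> s t Ds Dt st; have [] := bx s t Ds Dt st.
pose g i j t := beta (r t) i j.
have gK i j s t : s <= t -> `|g i j t - g i j s| <= K * (t - s).
  move=> st; have /andP[rs rt] := r1 s t st.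
  have [H _] := @ler_control_increment R d A K beta (r s) (r t) sb rs (bA _ _ (rD s) (rD t)).
  apply: (@le_trans _ _ (K * (r t - r s))); last by rewrite ler_wpM2l// lerBlDl.
  apply: le_trans H; have := mx_coord_le (beta (r t) - beta (r s)) i j.
  by rewrite /g !mxE.
have gc i j : continuous (g i j).
  by move=> t; apply: (lipschitz_near_continuous K0) => p q pq _ _; exact: gK.
have [N [mN N0 HN]] : lebesgue_measure.-negligible
   (E `|` [set t | ~ forall ij : 'I_d * 'I_d, derivable (g ij.1 ij.2) t 1]).
  apply: negligibleU => //.
  apply: (@filter_forall R ('I_d * 'I_d)%type
      (fun ij t => derivable (g ij.1 ij.2) t 1) _
      (ae_filter_ringOfSetsType lebesgue_measure)) => ij.
  exact: (lipschitz_ae_derivable K0 (gK ij.1 ij.2)).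
have dg t i j : ~ N t -> derivable (g i j) t 1.
  move=> Nt; apply: contrapT => H; apply: Nt; apply: HN; right => /(_ (i, j)).
  exact: H.
(* [B0] is a default on the null set [N]: a law takes its values in [A] at every time of [D]. *)
pose B t := if t \in N then B0 else \matrix_(i, j) 'D_1 (g i j) t.
have dB t : ~ N t -> is_derive t 1 (fun s => beta (r s)) (B t).
  move=> Nt; rewrite /B memNset//; apply/is_derive_mxP => i j; rewrite mxE.
  exact: (@DeriveDef _ _ _ _ _ _ _ (dg t i j Nt)).
have near2 t : D t -> ~ N t -> exists2 h, 0 < h & forall s, `|s - t| < h -> D s.
  by move=> Dt Nt; apply: near_ballP; apply: Dnear => // Et; apply: Nt; apply: HN; left.
exists B; split.
- move=> t Dt; have [Nt|Nt] := pselect (N t); first by rewrite /B mem_set.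
  have [h h0 Hh] := near2 t Dt Nt.
  apply: clA => U /nbhs_ballP[e/= e0 eU].
  have e20 : 0 < e / 2 by rewrite divr_gt0.
  have [h' h'0 Hh'] := near_ballP ((is_derive_nearP _ _ _).1 (dB t Nt) _ e20).
  pose k := Num.min h h' / 2.
  have k0 : 0 < k by rewrite divr_gt0// lt_min h0.
  have kh : k < h /\ k < h'.
    by rewrite /k; split; case: (leP h h'); lra.
  have tk : t + k - t = k by rewrite addrAC subrr add0r.
  have ktt : `|(t + k) - t| = k by rewrite tk ger0_norm// ltW.
  have Dtk : D (t + k) by apply: Hh; rewrite ktt; case: kh.
  exists (k^-1 *: (beta (t + k) - beta t)); split.
    have := bA t (t + k) Dt Dtk; rewrite ltrDl => /(_ k0).
    by rewrite tk.
  apply: eU; rewrite mx_norm_ball /ball_/=.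
  have := Hh' (t + k); rewrite ktt => /(_ kh.2).
  rewrite !rid// tk => H.
  have -> : B t - k^-1 *: (beta (t + k) - beta t) =
     - (k^-1 *: (beta (t + k) - beta t - k *: B t)).
    by rewrite [in RHS]scalerBr scalerA mulVf ?gt_eqF// scale1r opprB.
  rewrite normrN normrZ normfV (ger0_norm (ltW k0)).
  apply: (@le_lt_trans _ _ (e / 2)); first by rewrite ler_pdivrMl// mulrC.
  by rewrite ltr_pdivrMr// ltr_pMr// ltr1n.
- move=> i j.
  have -> : (fun t => B t i j) = (fun t => if t \in N then B0 i j else 'D_1 (g i j) t).
    by apply/funext => t; rewrite /B; case: ifPn => // _; rewrite mxE.
  apply: measurable_funTS; apply: measurable_derive_off_null => // t Nt.
  exact: dg.
- exists N; split => // t /=; apply: contra_notP => Nt Dt.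
  have [h h0 Hh] := near2 t Dt Nt.
  apply/is_derive_nearP => e e0.
  have e20 : 0 < e / 2 by rewrite divr_gt0.
  have dBx := (is_derive_nearP _ _ _).1 (is_derive_mulmxr (x t) (dB t Nt)) _ e20.
  have [h' h'0 Hh'] := near_ballP dBx.
  pose L := K ^+ 2 * m.
  have L0 : 0 <= L by rewrite /L mulr_ge0 ?sqr_ge0.
  have L20 : 0 <= 2 * L by rewrite mulr_ge0.
  have q0 : 0 < e / 2 / (2 * L + 1) by rewrite divr_gt0// ltr_wpDl.
  near=> s.
  have Ds : D s by apply: Hh; rewrite distrC; near: s; exact: cvgr_dist_lt.
  have := Hh' s; rewrite !rid// => Hs.
  have {}Hs : `|beta s *m x t - beta t *m x t - (s - t) *: (B t *m x t)| <= e / 2 * `|s - t|.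
    by apply: Hs; rewrite distrC; near: s; exact: cvgr_dist_lt.
  have Hq : 2 * L * `|s - t| <= e / 2.
    have : `|s - t| <= e / 2 / (2 * L + 1).
      by rewrite distrC; near: s; exact: cvgr_dist_le.
    rewrite ler_pdivlMr ?ltr_wpDl// mulrC; apply: le_trans.
    by rewrite ler_wpM2r// lerDl.
  (* For [s < t] the hypothesis expands [x] at [s]; moving the base point to [t] costs
     [(beta t - beta s) *m (x t - x s)], which is again at most [L * (t - s) ^+ 2]. Hence the factor
     2. *)
  have Hx : `|x s - x t - (beta s - beta t) *m x t| <= 2 * L * `|s - t| * `|s - t|.
    have [ts|/ltW st] := leP t s.
      have [_] := bx t s Dt Ds ts; move/le_trans; apply.
      rewrite ger0_norm ?subr_ge0// -/L -mulrA -expr2 ler_wpM2r ?sqr_ge0//; lra.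
    have [X1 X2] := bx s t Ds Dt st.
    have [_ X3] := @ler_control_increment R d A K beta s t sb st (bA _ _ Ds Dt).
    have {}X3 := X3 (x t - x s).
    have -> : x s - x t - (beta s - beta t) *m x t =
       (beta t - beta s) *m (x t - x s) - (x t - x s - (beta t - beta s) *m x s).
      rewrite !mulmxBl !mulmxBr; apply/matrixP => i j; rewrite !mxE; ring.
    apply: (le_trans (ler_normB _ _)).
    have -> : `|s - t| = t - s by rewrite distrC ger0_norm ?subr_ge0.
    have -> : 2 * L * (t - s) * (t - s) = L * (t - s) ^+ 2 + L * (t - s) ^+ 2 by ring.
    apply: lerD => //; apply: (le_trans X3).
    have -> : L * (t - s) ^+ 2 = K * (t - s) * (K * m * (t - s)) by rewrite /L; ring.
    by rewrite ler_wpM2l// mulr_ge0// subr_ge0.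
  have -> : x s - x t - (s - t) *: (B t *m x t) =
     (x s - x t - (beta s - beta t) *m x t) +
     (beta s *m x t - beta t *m x t - (s - t) *: (B t *m x t)).
    by rewrite mulmxBl; apply/matrixP => i j; rewrite !mxE; ring.
  apply: (le_trans (ler_normD _ _)).
  apply: (@le_trans _ _ (e / 2 * `|s - t| + e / 2 * `|s - t|)).
    by apply: lerD => //; apply: (le_trans Hx); rewrite ler_wpM2r.
  by rewrite -mulrDl -splitr.
Unshelve. all: by end_near.
Qed.

(** * Limits along ultrafilters *)

Lemma ultra_cluster_cvg (T : Type) (V : topologicalType) (U : set_system T)
    (u : T -> V) (p : V) :
  UltraFilter U -> cluster (u @ U) p -> u @ U --> p.
Proof.
move=> UU cp W Wp; have [//|UC] := in_ultra_setVsetC (u @^-1` W) UU.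
have [z [nWz Wz]] := cp (~` W) W UC Wp.
by case: nWz.
Qed.

Lemma cvg_mx_of_coord (T : Type) (R : realType) m n (F : set_system T)
    (u : T -> 'M[R]_(m, n)) (l : 'M[R]_(m, n)) :
  Filter F -> (forall i j, u k i j @[k --> F] --> l i j) -> u k @[k --> F] --> l.
Proof.
move=> FF ul; apply/cvgrPdist_le => e e0.
have H : \forall k \near F, forall ij, `|l ij.1 ij.2 - u k ij.1 ij.2| <= e.
  apply: (@filter_forall T ('I_m * 'I_n)%type
    (fun ij k => `|l ij.1 ij.2 - u k ij.1 ij.2| <= e)) => ij.
  by have /cvgrPdist_le := ul ij.1 ij.2; apply.
apply: filterS H => k Hk; apply: mx_norm_le => [|i j]; first exact: ltW.
by rewrite !mxE; exact: Hk (i, j).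
Qed.

(** One ultrafilter gives limits to all bounded sequences at once, hence to a sequence of
    trajectories at every time, without extracting subsequences. *)
Lemma ultra_cvg_bounded (T : Type) (R : realType) m n (U : set_system T)
    (u : T -> 'M[R]_(m, n)) (C : R) :
  UltraFilter U -> (\forall k \near U, `|u k| <= C) ->
  exists l : 'M[R]_(m, n), u k @[k --> U] --> l.
Proof.
move=> UU uC.
have /choice[l Hl] (ij : 'I_m * 'I_n) : exists l : R, u k ij.1 ij.2 @[k --> U] --> l.
  have [|l [_ cl]] := @segment_compact R (- C) C
      ((fun k => u k ij.1 ij.2) @ U) (fmap_proper_filter _ _).
    apply: filterS uC => k Hk; rewrite /= in_itv/= -ler_norml.
    exact: le_trans (mx_coord_le _ _ _) Hk.
  by exists l; exact: ultra_cluster_cvg.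
exists (\matrix_(i, j) l (i, j)); apply: cvg_mx_of_coord => i j.
by rewrite mxE; exact: Hl (i, j).
Qed.

Lemma norm_lim_le (T : Type) (R : realType) (V : normedModType R) (U : set_system T)
    (u : T -> V) (l : V) (C : R) :
  ProperFilter U -> u k @[k --> U] --> l -> (\forall k \near U, `|u k| <= C) -> `|l| <= C.
Proof.
move=> FU ul uC; apply: (closed_cvg (fun v : V => `|v| <= C) _ _ _ ul) => //.
rewrite -[X in closed X]/(Num.norm @^-1` [set y : R | y <= C]).
apply: preimage_closed; last exact: closed_le.
by move=> v _; exact: norm_continuous.
Qed.

Lemma mx_bounded_closed_compact (R : realType) m n (P : set 'M[R]_(m, n)) (C : R) :
  closed P -> (forall v, P v -> `|v| <= C) -> compact P.
Proof.
move=> cP PC; rewrite compact_ultra => F UF FP.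
have [l Hl] := @ultra_cvg_bounded _ _ _ _ F id C UF (filterS PC FP).
exists l; split=> //.
exact: (closed_cvg (u_ := id) P cP FP l Hl).
Qed.

(** * Locally Lipschitz functions on the half-line *)

Definition loc_lipschitz (R : realType) (V : normedModType R) (z : R -> V) :=
  forall T : R, exists2 C : R, 0 <= C &
    forall s t, 0 <= s -> s <= t -> t <= T -> `|z t - z s| <= C * (t - s).

Lemma loc_lipschitz_measurable (R : realType) (z : R -> R) :
  loc_lipschitz z -> measurable_fun (`[0, +oo[%classic : set R) z.
Proof.
move=> zL; pose g t := z (Num.max 0 t).
have cg : continuous g.
  move=> t; have [C C0 HC] := zL (`|t| + 1).
  apply: (lipschitz_near_continuous C0) => p q pq _ tq.
  have t10 : 0 <= `|t| + 1 by rewrite addr_ge0.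
  have qt : q <= `|t| + 1.
    by have tt := ler_norm t; move: tq; rewrite ler_norml => /andP[]; lra.
  apply: (@le_trans _ _ (C * (Num.max 0 q - Num.max 0 p))).
    apply: HC; first by rewrite le_max lexx.
      by rewrite ge_max !le_max lexx pq orbT.
    by rewrite ge_max t10.
  by rewrite ler_wpM2l//; case: (leP 0 q); case: (leP 0 p) => p0 q0; lra.
have H := measurable_funTS (D := (`[0, +oo[%classic : set R)) (continuous_measurable_fun cg).
apply: eq_measurable_fun H => t; rewrite inE/= in_itv/= andbT => t0.
by rewrite /g max_r.
Qed.

Lemma loc_lipschitz_bounded (R : realType) (V : normedModType R) (z : R -> V) (T : R) :
  loc_lipschitz z -> exists C : R, forall t, 0 <= t <= T -> `|z t| <= C.
Proof.
move=> /(_ T)[C C0 HC]; exists (C * `|T| + `|z 0|) => t /andP[t0 tT].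
rewrite -[z t](subrK (z 0)) (le_trans (ler_normD _ _))// lerD2r.
apply: (le_trans (HC 0 t (lexx _) t0 tT)).
by rewrite subr0 ler_wpM2l// (le_trans tT)// ler_norm.
Qed.

(** * Linear equations with a measurable law *)

Definition law_bound (R : realType) d (B : R -> 'M[R]_d) (K : R) :=
  forall t, 0 <= t -> `|B t| <= K /\ forall v : 'cV[R]_d, `|B t *m v| <= K * `|v|.

(** [Z] is [q] plus the integral of [B z] from 0, expressed through its derivative; local Lipschitz
    continuity makes that derivative determine [Z] on the half-line. With [Z = z] this is the
    initial value problem. *)
Definition picard_step (R : realType) d (B : R -> 'M[R]_d) (q : 'cV[R]_d)
    (z Z : R -> 'cV[R]_d) :=
  [/\ loc_lipschitz Z, Z 0 = q &
      {ae lebesgue_measure, forall t : R, 0 <= t -> is_derive t 1 Z (B t *m z t)}].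

Lemma loc_lipschitz_ac (R : realType) (V : normedModType R) (z : R -> V) (s t : R) :
  loc_lipschitz z -> 0 <= s -> ac_size s t (fun u v => `|z v - z u|).
Proof.
move=> /(_ t)[C C0 HC] s0; apply: (ac_size_lipschitz C0) => u v su uv vt.
by apply: HC => //; exact: le_trans su.
Qed.

Lemma picard_step_exists (R : realType) d (B : R -> 'M[R]_d) (K : R) q z :
  law_bound B K -> 0 <= K ->
  (forall i j, measurable_fun (`[0, +oo[%classic : set R) (fun t => B t i j)) ->
  loc_lipschitz z -> exists Z, picard_step B q z Z.
Proof.
move=> BK K0 mB zL.
have zb T : exists C, forall t, 0 <= t <= T -> `|B t *m z t| <= K * C.
  have [C HC] := loc_lipschitz_bounded T zL; exists C => t /andP[t0 tT].
  have [_ H] := BK t t0; apply: (le_trans (H _)); rewrite ler_wpM2l// HC//.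
  by rewrite t0.
have /choice[G HG] (i : 'I_d) : exists G : R -> R,
    [/\ G 0 = 0, loc_lipschitz G &
    {ae lebesgue_measure, forall t : R, 0 <= t -> is_derive t 1 G ((B t *m z t) i ord0)}].
  have [||G [G0 GC dG]] := @bounded_measurable_primitive R 0 (fun t => (B t *m z t) i ord0).
  - have -> : (fun t => (B t *m z t) i ord0) = fun t => \sum_k B t i k * z t k ord0.
      by apply/funext => t; rewrite mxE.
    apply: measurable_sum => k; apply: measurable_funM => //.
    apply: loc_lipschitz_measurable => T; have [C C0 HC] := zL T; exists C => // s t s0 st tT.
    apply: le_trans (HC s t s0 st tT); have := mx_coord_le (z t - z s) k ord0.
    by rewrite !mxE.
  - move=> T; have [C HC] := zb T; exists (K * C) => t /HC.
    by apply: le_trans; exact: mx_coord_le.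
  exists G; split=> // T; have [C HC] := zb T; exists `|K * C| => // s t s0 st tT.
  apply: GC => // u /andP[su ut]; apply: le_trans (ler_norm _).
  apply: (le_trans (mx_coord_le _ _ _)); apply: HC.
  by rewrite (le_trans s0 su) (le_trans ut tT).
pose Z t : 'cV[R]_d := q + \col_i G i t.
exists Z; split.
- move=> T; have [C HC] := zb T.
  have /choice[c Hc] (i : 'I_d) : exists C : R, 0 <= C /\
      forall s t, 0 <= s -> s <= t -> t <= T -> `|G i t - G i s| <= C * (t - s).
    by have [_ /(_ T)[c c0 H] _] := HG i; exists c.
  have c0 i : 0 <= c i by have [] := Hc i.
  exists (\sum_i c i); first by rewrite sumr_ge0.
  move=> s t s0 st tT; apply: mx_norm_le => [|i j].
    by rewrite mulr_ge0 ?sumr_ge0 ?subr_ge0.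
  rewrite !mxE opprD addrACA subrr add0r.
  have [_ H] := Hc i; apply: (le_trans (H s t s0 st tT)).
  rewrite ler_wpM2r ?subr_ge0// (bigD1 i)//= lerDl sumr_ge0//.
- apply/colP => i; rewrite !mxE; have [-> _ _] := HG i; exact: addr0.
- have : {ae lebesgue_measure, forall t : R, forall i : 'I_d,
      0 <= t -> is_derive t 1 (G i) ((B t *m z t) i ord0)}.
    apply: (@filter_forall R 'I_d
      (fun i t => 0 <= t -> is_derive t 1 (G i) ((B t *m z t) i ord0)) _
      (ae_filter_ringOfSetsType lebesgue_measure)) => i.
    by have [] := HG i.
  apply: filterS; first exact: (ae_filter_ringOfSetsType lebesgue_measure).
  move=> t H t0; apply/is_derive_mxP => i j; rewrite [j]ord1.
  have /is_derive_nearP {}H := H i t0.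
  apply/is_derive_nearP => e e0; apply: filterS (H e e0) => s.
  by rewrite !mxE opprD addrACA subrr add0r.
Qed.

(** The constant depends on [z] only through [M]: iterates with a common bound are equi-Lipschitz,
    and so is their pointwise limit. *)
Lemma picard_step_lipschitz (R : realType) d (B : R -> 'M[R]_d) (K M T : R) q z Z :
  law_bound B K -> 0 <= K -> 0 <= M -> picard_step B q z Z ->
  (forall t, 0 <= t <= T -> `|z t| <= M) ->
  forall s t, 0 <= s -> s <= t -> t <= T -> `|Z t - Z s| <= K * M * (t - s).
Proof.
move=> BK K0 M0 [ZL Z0 dZ] zM s t s0 st tT.
have -> : K * M * (t - s) = (fun u => K * M * u) t - (fun u => K * M * u) s.
  by rewrite /= mulrBr.
apply: (@ac_mean_value _ _ Z (fun u => B u *m z u) _ (fun=> K * M) s t _ st _ dZ) => //.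
- exact: loc_lipschitz_ac.
- by move=> u v _ uv _; rewrite ler_wpM2l// mulr_ge0.
- by move=> u _; exact: is_derive_mulr.
- move=> u /andP[su ut] /contrapT Hu; have u0 := le_trans s0 su.
  split; first exact: Hu.
  have [_ H] := BK u u0; apply: (le_trans (H _)); rewrite ler_wpM2l// zM// u0.
  exact: le_trans tT.
Qed.

Lemma is_derive_expR_mul (R : realType) (c k t : R) :
  is_derive t 1 (fun u => c * expR (k * u)) (c * (k * expR (k * t))).
Proof.
have dk : is_derive t 1 (fun u => k * u) k by exact: is_derive_mulr.
have := @is_derive1_comp R expR (fun u => k * u) t _ _ (is_derive_expR (k * t)) dk.
move=> H; have := @is_deriveZ R R R (expR \o (fun u => k * u)) c t 1 _ H.
by rewrite /GRing.scale/= [expR _ * k]mulrC.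
Qed.

(* Picard's operator is a contraction for the norm weighted by exp (-2Kt). *)
Lemma picard_contract (R : realType) d (B : R -> 'M[R]_d) (K M : R) q z Z z' Z' :
  law_bound B K -> 0 <= K -> 0 <= M -> picard_step B q z Z -> picard_step B q z' Z' ->
  (forall t, 0 <= t -> `|z t - z' t| <= M * expR (2 * K * t)) ->
  forall t, 0 <= t -> `|Z t - Z' t| <= M / 2 * expR (2 * K * t).
Proof.
move=> BK K0 M0 [ZL Z0 dZ] [ZL' Z0' dZ'] zM t t0.
(* The derivative of [phi] is [K * (M * expR (2 * K * u))], exactly the bound for
   [B u *m (z u - z' u)]; the contraction factor 1/2 is the inverse of the 2 in the exponent. *)
pose phi u := M / 2 * expR (2 * K * u).
apply: (@le_trans _ _ (phi t - phi 0)); last first.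
  by rewrite gerBl mulr_ge0 ?divr_ge0// expR_ge0.
have -> : Z t - Z' t = (fun u => Z u - Z' u) t - (fun u => Z u - Z' u) 0.
  by rewrite /= Z0 Z0' subrr subr0.
have FF := ae_filter_ringOfSetsType (@lebesgue_measure R).
have {}dZ : {ae lebesgue_measure, forall u : R,
    (0 <= u -> is_derive u 1 Z (B u *m z u)) /\ (0 <= u -> is_derive u 1 Z' (B u *m z' u))}.
  exact: filterI dZ dZ'.
have K20 : 0 <= 2 * K by rewrite mulr_ge0.
apply: (@ac_mean_value _ _ (fun u => Z u - Z' u) (fun u => B u *m z u - B u *m z' u) phi
  (fun u => M / 2 * (2 * K * expR (2 * K * u))) 0 t _ t0 _ dZ) => //.
- have [C C0 HC] := ZL t; have [C' C0' HC'] := ZL' t.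
  apply: (ac_size_lipschitz (addr_ge0 C0 C0')) => u v su uv vt.
  have -> : Z v - Z' v - (Z u - Z' u) = (Z v - Z u) - (Z' v - Z' u).
    by apply/matrixP => i j; rewrite !mxE; ring.
  by rewrite mulrDl (le_trans (ler_normB _ _))// lerD// (HC, HC').
- by move=> u v _ uv _; rewrite /phi ler_wpM2l ?divr_ge0// ler_expR ler_wpM2l.
- by move=> u _; exact: is_derive_expR_mul.
- move=> u /andP[u0 ut] /contrapT[/(_ u0) H1 /(_ u0) H2].
  split; first exact: is_deriveB.
  have [_ H] := BK u u0; rewrite -mulmxBr (le_trans (H _))//.
  have -> : M / 2 * (2 * K * expR (2 * K * u)) = K * (M * expR (2 * K * u)) by field.
  by rewrite ler_wpM2l// zM.
Qed.

Lemma eq0_geometric_bound (R : realType) (V : normedModType R) (v : V) (C : R) :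
  (forall n, `|v| <= C / 2 ^+ n) -> v = 0.
Proof.
move=> H; apply/eqP; rewrite -normr_eq0 eq_le normr_ge0 andbT leNgt; apply/negP => v0.
have C0 : 0 <= C by have := H 0%N; rewrite expr0 divr1; exact: le_trans.
have := archi_boundP (divr_ge0 C0 (ltW v0)); set n := Num.bound _ => Hn.
have := H n; rewrite ler_pdivlMr ?exprn_gt0// => Hle.
have n2 : n%:R <= 2 ^+ n :> R by rewrite -natrX ler_nat ltnW// ltn_expl.
move: Hn; rewrite ltr_pdivrMr// ltNge => /negP; apply; apply: le_trans Hle.
by rewrite mulrC ler_wpM2l// ltW.
Qed.

(** In the weighted norm the Picard iterates converge geometrically on the whole half-line at once,
    so no local solutions have to be glued. *)
Lemma caratheodory (R : realType) d (B : R -> 'M[R]_d) (K : R) (q : 'cV[R]_d) :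
  law_bound B K -> 0 <= K ->
  (forall i j, measurable_fun (`[0, +oo[%classic : set R) (fun t => B t i j)) ->
  exists y, picard_step B q y y.
Proof.
move=> BK K0 mB.
pose E u := expR (2 * K * u); pose c := `|q|; pose M n := c / 2 ^+ n.
have c0 : 0 <= c by exact: normr_ge0.
have K20 : 0 <= 2 * K by rewrite mulr_ge0.
have E1 u : 0 <= u -> 1 <= E u by move=> u0; rewrite -expR0 ler_expR mulr_ge0.
have E0 u : 0 <= E u by exact: expR_ge0.
have MS n : M n.+1 = M n / 2 by rewrite /M exprSr invfM mulrA.
have M0 n : 0 <= M n by rewrite /M divr_ge0 ?exprn_ge0.
have constL (v : 'cV[R]_d) : loc_lipschitz (fun=> v : 'cV[R]_d).
  by move=> T; exists 0 => // s t _ _ _; rewrite subrr normr0 mul0r.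
pose S := {z : R -> 'cV[R]_d | loc_lipschitz z}.
have /choice[f Hf] (z : S) : exists Z : S, picard_step B q (sval z) (sval Z).
  have [Z HZ] := picard_step_exists q BK K0 mB (svalP z).
  have [ZL _ _] := HZ; by exists (exist _ Z ZL).
pose zs n := sval (iter n f (exist _ _ (constL q))).
have P n : picard_step B q (zs n) (zs n.+1) by exact: Hf.
(* The operator sends zero to the constant [q], the starting point of the iteration, so the
   contraction also bounds the first step. *)
have P0 : picard_step B q (fun=> 0) (fun=> q).
  split => //; apply: aeW => t t0; rewrite mulmx0; exact: is_derive_cst.
have D n t : 0 <= t -> `|zs n.+1 t - zs n t| <= M n.+1 * E t.
  elim: n t => [|n IH] t t0; rewrite MS.
    apply: (picard_contract BK K0 (M0 0%N) (P 0%N) P0) => // u u0.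
    by rewrite subr0 /M expr0 divr1 ler_peMr// E1.
  by apply: (picard_contract BK K0 (M0 n.+1) (P n.+1) (P n)) => // u u0; exact: IH.
have tail n m t : 0 <= t -> `|zs (n + m)%N t - zs n t| <= (M n - M (n + m)%N) * E t.
  move=> t0; elim: m => [|m IH]; first by rewrite addn0 !subrr normr0 mul0r.
  have -> : zs (n + m.+1)%N t - zs n t =
      (zs (n + m.+1)%N t - zs (n + m)%N t) + (zs (n + m)%N t - zs n t) by rewrite subrKA.
  apply: (le_trans (ler_normD _ _)); rewrite addnS.
  have := D (n + m)%N t t0 => H; apply: (le_trans (lerD H IH)).
  by rewrite -mulrDl ler_wpM2r// MS; lra.
have zsM n t : 0 <= t -> `|zs n t| <= 2 * c * E t.
  move=> t0; have := tail 0%N n t t0; rewrite add0n => H.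
  have -> : zs n t = (zs n t - zs 0%N t) + q by rewrite subrK.
  apply: (le_trans (ler_normD _ _)).
  have H2 : (M 0%N - M n) * E t <= c * E t.
    by rewrite ler_wpM2r// {1}/M expr0 divr1 gerBl.
  have H3 : `|q| <= c * E t by rewrite ler_peMr// E1.
  lra.
have [U [UU Uoo]] := ultraFilterLemma (F := \oo) _.
have /choice[y Hy] t : exists l : 'cV[R]_d, 0 <= t -> zs k t @[k --> U] --> l.
  have [t0|_] := boolP (0 <= t); last by exists 0.
  have [l Hl] := @ultra_cvg_bounded _ _ _ _ U (fun k => zs k t) (2 * c * E t) UU
    (filterE _ (fun k => zsM k t t0)).
  by exists l.
have yz n t : 0 <= t -> `|y t - zs n t| <= M n * E t.
  move=> t0; apply: (@norm_lim_le _ _ _ U (fun k => zs k t - zs n t)).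
    by apply: cvgB; [exact: Hy|exact: cvg_cst].
  apply: Uoo; exists n => // k /= nk; rewrite -(subnKC nk).
  by apply: (le_trans (tail _ _ _ t0)); rewrite ler_wpM2r// gerBl.
have yL : loc_lipschitz y.
  move=> T; have C0 : 0 <= 2 * c * E T by rewrite !mulr_ge0.
  exists (K * (2 * c * E T)); first by rewrite mulr_ge0.
  move=> s t s0 st tT.
  apply: (@norm_lim_le _ _ _ U (fun k => zs k t - zs k s)).
    by apply: cvgB; apply: Hy => //; exact: le_trans st.
  apply: Uoo; exists 1%N => // -[//|k] _ /=.
  apply: (picard_step_lipschitz BK K0 C0 (P k)) tT => // u /andP[u0 uT].
  apply: (le_trans (zsM _ _ u0)); rewrite ler_wpM2l// ?mulr_ge0//.
  by rewrite ler_expR ler_wpM2l.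
have [Y HY] := picard_step_exists q BK K0 mB yL.
have Yy t : 0 <= t -> Y t = y t.
  move=> t0; apply/eqP; rewrite -subr_eq0; apply/eqP.
  apply: (@eq0_geometric_bound _ _ _ (c * E t)) => n.
  have -> : Y t - y t = (Y t - zs n.+1 t) - (y t - zs n.+1 t) by rewrite opprB subrKA.
  apply: (le_trans (ler_normB _ _)).
  have H1 := picard_contract BK K0 (M0 n) HY (P n) (yz n) t0.
  have H2 := yz n.+1 t t0.
  apply: (le_trans (lerD H1 H2)); rewrite MS -mulrDl -splitr /M mulrAC//.
(* [Y], unlike the pointwise limit [y], has a known derivative; as both agree at nonnegative times,
   [y] may be replaced by [Y] in the right-hand side. *)
exists Y; have [YL Y0 dY] := HY; split=> //.
move: dY; apply: filterS; first exact: (ae_filter_ringOfSetsType lebesgue_measure).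
by move=> t H t0; rewrite Yy//; exact: H.
Qed.

Lemma ac_size_add (R : realType) (a b : R) (w w1 w2 : R -> R -> R) :
  ac_size a b w1 -> ac_size a b w2 -> (forall s t, w s t <= w1 s t + w2 s t) ->
  ac_size a b w.
Proof.
move=> H1 H2 ww e e0; have e20 : 0 < e / 2 by rewrite divr_gt0.
have [d1 d10 Hd1] := H1 _ e20; have [d2 d20 Hd2] := H2 _ e20.
exists (Num.min d1 d2); first by rewrite lt_min d10.
move=> n u v uv tI; rewrite lt_min => /andP[L1 L2].
apply: (@le_lt_trans _ _ (\sum_(i < n) w1 (u i) (v i) + \sum_(i < n) w2 (u i) (v i))).
  by rewrite -big_split/= ler_sum.
by rewrite [e]splitr; apply: ltrD; [exact: Hd1|exact: Hd2].
Qed.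

Lemma trajectory_same_law (R : realType) d (A : set 'M[R]_d) (K : R)
    (y : R -> 'cV[R]_d) (q : 'cV[R]_d) :
  size_bound A K -> trajectory A y ->
  exists z, [/\ trajectory A z, z 0 = q & trajectory A (fun t => z t - y t)].
Proof.
move=> [K0 AK] [acy [B [AB mB dy]]].
have AB' t : 0 <= t -> A (B t) by move=> t0; apply: AB; rewrite /= in_itv/= t0.
have BK : law_bound B K by move=> t t0; exact: AK (AB' t t0).
have [z [zL z0 dz]] := caratheodory q BK K0 mB.
have acz (a b : R) : a <= b -> `[a, b] `<=` `[0, +oo[ -> ac_size a b (fun u v => `|z v - z u|).
  move=> ab H; apply: loc_lipschitz_ac => //.
  have : `[0, +oo[%classic a by apply: H; rewrite /= in_itv/= lexx.
  by rewrite /= in_itv/= andbT.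
have {}dz : {ae lebesgue_measure, forall t : R, `[0, +oo[%classic t -> is_derive t 1 z (B t *m z t)}.
  move: dz; apply: filterS; first exact: (ae_filter_ringOfSetsType lebesgue_measure).
  by move=> t H; rewrite /= in_itv/= andbT; exact: H.
exists z; split=> //; first by split=> //; exists B.
split.
  move=> a b ab abD; change (ac_size a b (fun u v => `|z v - y v - (z u - y u)|)).
  apply: (ac_size_add (acz a b ab abD) (acy a b ab abD)) => s t.
  have -> : z t - y t - (z s - y s) = (z t - z s) - (y t - y s).
    by apply/matrixP => i j; rewrite !mxE; ring.
  exact: ler_normB.
exists B; split=> //.
move: dz dy; apply: filterS2; first exact: (ae_filter_ringOfSetsType lebesgue_measure).
move=> t Hz Hy Dt; rewrite mulmxBr.
by have := Hz Dt; have := Hy Dt => *; exact: is_deriveB.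
Qed.

(** * Shift, concatenation and compactness of solutions *)

Lemma cvg_mx_coord (T : Type) (R : realType) m n (F : set_system T)
    (u : T -> 'M[R]_(m, n)) (l : 'M[R]_(m, n)) i j :
  Filter F -> u k @[k --> F] --> l -> u k i j @[k --> F] --> l i j.
Proof.
move=> FF /cvgrPdist_le ul; apply/cvgrPdist_le => e e0.
apply: filterS (ul e e0) => k; apply: le_trans.
by have := mx_coord_le (l - u k) i j; rewrite !mxE.
Qed.

Lemma cvg_mulmx (T : Type) (R : realType) m n p (F : set_system T)
    (u : T -> 'M[R]_(m, n)) (v : T -> 'M[R]_(n, p)) (lu : 'M[R]_(m, n)) (lv : 'M[R]_(n, p)) :
  Filter F -> u k @[k --> F] --> lu -> v k @[k --> F] --> lv ->
  u k *m v k @[k --> F] --> lu *m lv.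
Proof.
move=> FF ul vl; apply: cvg_mx_of_coord => i j.
have -> : (fun k => (u k *m v k) i j) = fun k => \sum_a u k i a * v k a j.
  by apply/funext => k; rewrite mxE.
rewrite mxE; elim: (index_enum _) => [|a r IH].
  by rewrite big_nil; under eq_fun do rewrite big_nil; exact: cvg_cst.
rewrite big_cons; under eq_fun do rewrite big_cons.
by apply: cvgD => //; apply: cvgM; exact: cvg_mx_coord.
Qed.

Lemma integral_solution_shift (R : realType) d (K m tau : R) (A : set 'M[R]_d)
    (D D' : set R) (x : R -> 'cV[R]_d) :
  integral_solution K m A D x -> (forall t, D' t -> D (t + tau)) ->
  integral_solution K m A D' (fun t => x (t + tau)).
Proof.
move=> [xm [beta [bA bx]]] DD; split; first by move=> t /DD; exact: xm.
exists (fun t => beta (t + tau)).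
have E s t : t + tau - (s + tau) = t - s by rewrite opprD addrACA subrr addr0.
split=> s t /DD Ds /DD Dt st.
  by rewrite -E; apply: bA => //; rewrite ltrD2r.
by rewrite -E; apply: bx => //; rewrite lerD2r.
Qed.

Lemma integral_solution_trajectory (R : realType) d (K m : R) (A : set 'M[R]_d)
    (x : R -> 'cV[R]_d) :
  size_bound A K -> A !=set0 -> closed A ->
  integral_solution K m A `[0, +oo[ x -> trajectory A x.
Proof.
(* [Num.max 0] retracts the line onto the half-line, whose only non-interior point is 0. *)
move=> sb A0 clA; apply: (@integral_solution_solution _ _ _ _ _ _ [set 0] (Num.max 0)) => //.
- by move=> t; rewrite /= in_itv/= andbT le_max lexx.
- by move=> t; rewrite /= in_itv/= andbT => /max_r.
- by move=> s t st; apply/andP; split; case: (leP 0 s); case: (leP 0 t); lra.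
- by exists [set 0]; split => //; exact: lebesgue_measure_set1.
- move=> t; rewrite /= in_itv/= andbT => t0 tn0.
  have {}t0 : 0 < t by rewrite lt_neqAle t0 andbT eq_sym; apply/eqP.
  near=> s; rewrite /= in_itv/= andbT; apply: ltW; near: s; exact: lt_nbhsr.
Unshelve. all: by end_near.
Qed.

Lemma integral_solution_stem (R : realType) d (K m : R) (A : set 'M[R]_d)
    (x : R -> 'cV[R]_d) :
  size_bound A K -> A !=set0 -> closed A ->
  integral_solution K m A setT x -> stem A x.
Proof.
move=> sb A0 clA; apply: (@integral_solution_solution _ _ _ _ _ _ set0 id) => //.
- by move=> s t st /=; rewrite st addrC subrK lexx.
- exact: negligible_set0.
- by move=> t _ _; exact: filterT.
Qed.

(** The primitives are matched at [s0]. An average across [s0] is a convex combination of one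
    average from each piece. The error across [s0] consists of the errors of the two pieces and a
    cross term at most [K ^+ 2 * m * ((s0 - s) * (t - s0))], half of the double product in
    [K ^+ 2 * m * (t - s) ^+ 2]. *)
Lemma integral_solution_concat (R : realType) d (K m s0 : R) (A : set 'M[R]_d)
    (y z w : R -> 'cV[R]_d) :
  size_bound A K -> convex_set (A : set (convex_lmodType 'M[R]_d)) -> 0 <= s0 ->
  integral_solution K m A `[0, +oo[ y -> integral_solution K m A `[0, +oo[ z ->
  (forall t, 0 <= t -> t <= s0 -> w t = y t) ->
  (forall t, s0 <= t -> w t = z (t - s0)) ->
  integral_solution K m A `[0, +oo[ w.
Proof.
move=> sb cA s00 [ym [by_ [yA ybx]]] [zm [bz [zA zbx]]] wy wz.
have D (t : R) : 0 <= t -> `[0, +oo[%classic t by move=> t0; rewrite /= in_itv/= t0.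
have yz : y s0 = z 0 by rewrite -wy// wz// subrr.
have [K0 AK] := sb.
have m0 : 0 <= m by apply: le_trans (ym 0 (D _ (lexx _))).
split.
  move=> t; rewrite /= in_itv/= andbT => t0; have [ts|/ltW st] := leP t s0.
    by rewrite wy// ym//; exact: D.
  by rewrite wz// zm//; apply: D; rewrite subr_ge0.
pose b t := if t <= s0 then by_ t else by_ s0 + bz (t - s0) - bz 0.
have b1 t : t <= s0 -> b t = by_ t by rewrite /b => ->.
have b2 t : s0 <= t -> b t = by_ s0 + bz (t - s0) - bz 0.
  rewrite /b => st; case: ifPn => // ts; have -> : t = s0 by apply/le_anti; rewrite ts.
  by rewrite subrr addrK.
exists b.
have mid s t : 0 <= s -> s <= s0 -> s0 <= t ->
    b t - b s = (by_ s0 - by_ s) + (bz (t - s0) - bz 0).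
  move=> ss st sst; rewrite (b1 s)// (b2 t)//; apply/matrixP => i j; rewrite !mxE; ring.
have E (s t : R) : (t - s0) - (s - s0) = t - s by ring.
split=> s t; rewrite /= !in_itv/= !andbT => s_0 t_0 st.
  have [ts|/ltW s0t] := leP t s0.
    by rewrite !b1 ?(le_trans (ltW st))//; apply: yA => //; exact: D.
  have [s0s|ss0] := leP s0 s.
    have -> : b t - b s = bz (t - s0) - bz (s - s0).
      by rewrite !b2//; apply/matrixP => i j; rewrite !mxE; ring.
    by rewrite -(E s t); apply: zA; rewrite ?ltrD2r//; apply: D; rewrite subr_ge0.
  rewrite mid// ?ltW//.
  have AY := yA s s0 (D _ s_0) (D _ s00) ss0.
  have [s0t'|ts0] := ltP s0 t; last first.
    have -> : t = s0 by apply/le_anti; rewrite ts0.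
    by rewrite subrr subrr addr0.
  have ts0 : 0 < t - s0 by rewrite subr_gt0.
  have := zA 0 (t - s0) (D _ (lexx _)) (D _ (ltW ts0)) ts0.
  rewrite subr0 => AZ.
  have ts : 0 < t - s by rewrite subr_gt0.
  have s0s : 0 < s0 - s by rewrite subr_gt0.
  have := @convex_setP _ _ A cA _ _ ((s0 - s) / (t - s)) AY AZ.
  rewrite ler_pdivrMr// mul1r lerD2r s0t divr_ge0 ?ltW// => /(_ isT).
  congr A; apply/matrixP => i j; rewrite !mxE; field.
  by rewrite !gt_eqF.
have [ts|/ltW s0t] := leP t s0.
  by rewrite !b1 ?wy ?(le_trans st)//; apply: ybx => //; exact: D.
have [s0s|/ltW ss0] := leP s0 s.
  have -> : b t - b s = bz (t - s0) - bz (s - s0).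
    by rewrite !b2//; apply/matrixP => i j; rewrite !mxE; ring.
  by rewrite -(E s t) !wz//; apply: zbx; rewrite ?lerD2r//; apply: D; rewrite subr_ge0.
have ts0 : 0 <= t - s0 by rewrite subr_ge0.
have [Y1 Y2] := ybx s s0 (D _ s_0) (D _ s00) ss0.
have [Z1 Z2] := zbx 0 (t - s0) (D _ (lexx _)) (D _ ts0) ts0.
rewrite subr0 in Z1 Z2.
have [_ Z3] := @ler_control_increment R d A K bz 0 (t - s0) sb ts0
  (zA _ _ (D _ (lexx _)) (D _ ts0)).
rewrite mid// (wy s)// (wz t)//.
have E2 : z (t - s0) - y s = (y s0 - y s) + (z (t - s0) - z 0) by rewrite yz [RHS]addrC subrKA.
split.
  rewrite E2 (le_trans (ler_normD _ _))//.
  have -> : K * m * (t - s) = K * m * (s0 - s) + K * m * (t - s0) by ring.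
  exact: lerD.
have -> : z (t - s0) - y s - (by_ s0 - by_ s + (bz (t - s0) - bz 0)) *m y s =
   (y s0 - y s - (by_ s0 - by_ s) *m y s) +
   (z (t - s0) - z 0 - (bz (t - s0) - bz 0) *m z 0) +
   (bz (t - s0) - bz 0) *m (y s0 - y s).
  by rewrite E2 -yz !mulmxDl !mulmxDr !mulNmx !mulmxN; apply/matrixP => i j; rewrite !mxE; ring.
apply: (le_trans (ler_normD _ _)).
apply: (le_trans (lerD (ler_normD _ _) (lexx _))).
apply: (le_trans (lerD (lerD Y2 Z2) (Z3 _))).
have H : K * (t - s0) * `|y s0 - y s| <= K * (t - s0) * (K * m * (s0 - s)).
  by rewrite ler_wpM2l// mulr_ge0.
rewrite subr0; apply: (le_trans (lerD (lexx _) H)).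
have q0 : 0 <= K ^+ 2 * m * ((s0 - s) * (t - s0)) by rewrite !mulr_ge0 ?sqr_ge0// subr_ge0.
rewrite -subr_ge0; apply: le_trans q0 _.
by rewrite le_eqVlt; apply/orP; left; apply/eqP; ring.
Qed.

(** All the conditions are closed and have constants independent of [n]. The domains [D_ n] need
    only contain each time eventually, so that shifted trajectories with longer and longer pasts can
    converge to a stem. *)
Lemma integral_solution_ultralimit (R : realType) d (K m : R) (A : set 'M[R]_d)
    (D : set R) (D_ : nat -> set R) (x_ : nat -> R -> 'cV[R]_d) (U : set_system nat) :
  size_bound A K -> closed A -> UltraFilter U -> D 0 ->
  (forall t, D t -> \forall n \near U, D_ n t) ->
  (forall n, integral_solution K m A (D_ n) (x_ n)) ->
  exists2 x, integral_solution K m A D x &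
    forall t, D t -> x_ n t @[n --> U] --> x t.
Proof.
move=> sb clA UU D0 DD IS; have [K0 AK] := sb.
have PU : ProperFilter U by exact: ultra_proper.
have xm n t : D_ n t -> `|x_ n t| <= m by have [H _] := IS n; exact: H.
have /choice[b Hb] n : exists b : R -> 'M[R]_d,
    (forall s t, D_ n s -> D_ n t -> s < t -> A ((t - s)^-1 *: (b t - b s))) /\
    forall s t, D_ n s -> D_ n t -> s <= t ->
      `|x_ n t - x_ n s| <= K * m * (t - s) /\
      `|x_ n t - x_ n s - (b t - b s) *m x_ n s| <= K ^+ 2 * m * (t - s) ^+ 2.
  by have [_] := IS n.
have /choice[x Hx] t : exists l : 'cV[R]_d, D t -> x_ n t @[n --> U] --> l.
  have [Dt|nDt] := pselect (D t); last by exists 0.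
  have [l Hl] := @ultra_cvg_bounded _ _ _ _ U (fun n => x_ n t) m UU
    (filterS (fun n => @xm n t) (DD t Dt)).
  by exists l.
(* Only the increments of the primitives are bounded, so these are normalized at time 0 before the
   limit is taken. *)
have /choice[be Hbe] t : exists l : 'M[R]_d, D t -> b n t - b n 0 @[n --> U] --> l.
  have [Dt|nDt] := pselect (D t); last by exists 0.
  have H : \forall n \near U, `|b n t - b n 0| <= K * `|t|.
    apply: filterS2 (DD t Dt) (DD 0 D0) => n Dnt Dn0; have [bA _] := Hb n.
    have [t0|/ltW t0] := leP 0 t.
      have [H _] := @ler_control_increment R d A K (b n) 0 t sb t0 (bA _ _ Dn0 Dnt).
      by rewrite ger0_norm//; rewrite subr0 in H.
    have [H _] := @ler_control_increment R d A K (b n) t 0 sb t0 (bA _ _ Dnt Dn0).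
    by rewrite distrC ler0_norm//; rewrite sub0r in H.
  have [l Hl] := @ultra_cvg_bounded _ _ _ _ U (fun n => b n t - b n 0) (K * `|t|) UU H.
  by exists l.
have bst s t : D s -> D t -> b n t - b n s @[n --> U] --> be t - be s.
  move=> Ds Dt.
  have -> : (fun n => b n t - b n s) = fun n => (b n t - b n 0) - (b n s - b n 0).
    by apply/funext => n; rewrite opprB subrKA.
  by apply: cvgB; exact: Hbe.
exists x => //; split.
  move=> t Dt; apply: (norm_lim_le PU (Hx t Dt)).
  by apply: filterS (DD t Dt) => n; exact: xm.
exists be; split=> s t Ds Dt st.
  apply: (closed_cvg A clA _ _ (cvgZ (cvg_cst _) (bst s t Ds Dt))).
  by apply: filterS2 (DD s Ds) (DD t Dt) => n Dns Dnt; have [bA _] := Hb n; exact: bA.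
have near2 (P : nat -> Prop) : (forall n, D_ n s -> D_ n t -> P n) -> \forall n \near U, P n.
  by move=> H; exact: filterS2 (DD s Ds) (DD t Dt).
split.
  apply: (norm_lim_le PU (cvgB (Hx t Dt) (Hx s Ds))).
  by apply: near2 => n Dns Dnt; have [_ H] := Hb n; have [] := H s t Dns Dnt st.
apply: (norm_lim_le PU (cvgB (cvgB (Hx t Dt) (Hx s Ds))
  (cvg_mulmx _ (bst s t Ds Dt) (Hx s Ds)))).
by apply: near2 => n Dns Dnt; have [_ H] := Hb n; have [] := H s t Dns Dnt st.
Qed.

(** * Trajectories and the invariant norm *)

Lemma norm_function_le (R : realType) d (f : 'cV[R]_d -> R) :
  is_norm f -> exists2 C, 0 <= C & forall v, f v <= C * `|v|.
Proof.
move=> [f0 _ fZ fD].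
have f00 : f 0 = 0 by rewrite -[0](scale0r 0) fZ normr0 mul0r.
exists (\sum_(i < d) f (delta_mx i ord0)); first by rewrite sumr_ge0.
move=> v; rewrite {1}[v]matrix_sum_delta.
apply: (@le_trans _ _ (\sum_(i < d) `|v i ord0| * f (delta_mx i ord0))).
  elim/big_rec2 : _ => [|i a b _ ab]; first by rewrite f00.
  rewrite big_ord1; apply: (le_trans (fD _ _)); rewrite fZ lerD2l//.
rewrite mulr_suml; apply: ler_sum => i _; rewrite mulrC ler_wpM2l//.
exact: mx_coord_le.
Qed.

Lemma norm_function_distr (R : realType) d (f : 'cV[R]_d -> R) C :
  is_norm f -> (forall v, f v <= C * `|v|) -> forall v w, `|f v - f w| <= C * `|v - w|.
Proof.
move=> [f0 _ fZ fD] fC v w.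
have fN u : f (- u) = f u by rewrite -scaleN1r fZ normrN1 mul1r.
have key a b : f a - f b <= C * `|a - b|.
  rewrite lerBlDr; apply: (le_trans _ (lerD (fC _) (lexx _))).
  by rewrite -{1}[a](subrK b); exact: fD.
rewrite ler_norml key andbT lerNl opprB distrC.
exact: key.
Qed.

(** If no constant worked, there would be unit vectors [w n] with [f (w n)] tending to 0, and [f]
    would vanish at their nonzero limit. *)
Lemma norm_function_ge (R : realType) d (f : 'cV[R]_d -> R) :
  is_norm f -> exists2 c, 0 <= c & forall v, `|v| <= c * f v.
Proof.
move=> nf; have [C C0 fC] := norm_function_le nf.
have [f0 f_eq0 fZ fD] := nf.
apply: contrapT => H.
have /choice[v Hv] (n : nat) : exists v, n.+1%:R * f v < `|v|.
  apply: contrapT => Hn; apply: H; exists n.+1%:R => // v.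
  by rewrite leNgt; apply/negP => vn; apply: Hn; exists v.
have v0 n : 0 < `|v n| by apply: le_lt_trans (Hv n); rewrite mulr_ge0.
pose w n := `|v n|^-1 *: v n.
have w1 n : `|w n| = 1 by rewrite normrZ normfV normr_id mulVf// gt_eqF.
have fw n : f (w n) <= n.+1%:R^-1.
  rewrite fZ normfV normr_id ler_pdivrMl// ler_pdivlMr// mulrC.
  exact: ltW.
have [U [UU Uoo]] := ultraFilterLemma (F := \oo) _.
have wle1 n : `|w n| <= 1 by rewrite w1.
have [l Hl] := @ultra_cvg_bounded _ _ _ _ U w 1 UU (filterE _ wle1).
have near_e e : 0 < e -> exists n, `|l - w n| <= e /\ n.+1%:R^-1 <= e.
  move=> e0; have /cvgrPdist_le/(_ e e0) H1 := Hl.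
  have H2 : \forall n \near U, n.+1%:R^-1 <= e.
    apply: Uoo; near=> n; apply: ltW; near: n.
    exact: near_infty_natSinv_lt (PosNum e0).
  by have [n] := filter_ex (filterI H1 H2); exists n.
have fl : f l = 0.
  apply/le_anti; rewrite f0 andbT; apply/ler_addgt0Pr => e e0; rewrite add0r.
  have e'0 : 0 < e / (C + 1) by rewrite divr_gt0// ltr_wpDl.
  have [n [H1 H2]] := near_e _ e'0.
  rewrite -[l](subrK (w n)); apply: (le_trans (fD _ _)).
  apply: (le_trans (lerD (le_trans (fC _) (ler_wpM2l C0 H1)) (le_trans (fw n) H2))).
  rewrite -{2}[e / _]mul1r -mulrDl mulrC divfK// gt_eqF// ltr_wpDl//.
have [n [H1 _]] := near_e 2^-1 (ltac:(by rewrite invr_gt0)).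
have := ler_normD (w n - l) l; rewrite subrK w1 {2}(f_eq0 _ fl) normr0 addr0 distrC.
by move=> /le_trans/(_ H1); rewrite leNgt invf_lt1// ltr1n.
Unshelve. all: by end_near.
Qed.

Lemma switching_system_closed (R : realType) d (A : set 'M[R]_d) :
  switching_system A -> closed A.
Proof. by move=> [_ cA _ _]; apply: compact_closed => //; exact: norm_hausdorff. Qed.

Lemma trajectory_integral (R : realType) d (A : set 'M[R]_d) (K m : R) x :
  switching_system A -> size_bound A K -> trajectory A x ->
  (forall t, 0 <= t -> `|x t| <= m) -> integral_solution K m A `[0, +oo[ x.
Proof.
move=> sA sb tx xm; have [_ _ coA _] := sA.
exact: (solution_integral sb coA (switching_system_closed sA) _ tx).
Qed.

(** Source of the bound [m] in [integral_solution]; it depends on the trajectory only through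
    [f (x 0)]. *)
Lemma trajectory_bounded (R : realType) d (A : set 'M[R]_d) f :
  invariant_norm A f -> exists2 c, 0 <= c &
  forall x, trajectory A x -> forall t, 0 <= t -> `|x t| <= c * f (x 0).
Proof.
move=> [nf fd _]; have [c c0 H] := norm_function_ge nf; exists c => // x tx t t0.
by apply: (le_trans (H _)); rewrite ler_wpM2l//; exact: fd.
Qed.

Lemma trajectory_dependence (R : realType) d (A : set 'M[R]_d) f :
  switching_system A -> invariant_norm A f -> exists2 L, 0 <= L &
  forall y q, trajectory A y -> exists z, [/\ trajectory A z, z 0 = q &
    forall t, 0 <= t -> `|z t - y t| <= L * `|q - y 0|].
Proof.
move=> sA iA; have [c c0 H] := trajectory_bounded iA.
have [nf _ _] := iA; have [C C0 fC] := norm_function_le nf.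
have [_ cA _ _] := sA; have [K sb] := compact_size_bound cA.
(* [C] bounds [f] by the maximum norm at time 0 and [c] converts back at time [t]; in between, [f]
   of the difference does not increase. *)
exists (c * C); first exact: mulr_ge0.
move=> y q ty; have [z [tz z0 tzy]] := trajectory_same_law q sb ty.
exists z; split=> // t t0; apply: (le_trans (H _ tzy t t0)).
by rewrite -mulrA ler_wpM2l// z0.
Qed.

Lemma trajectory_concat (R : realType) d (A : set 'M[R]_d) f (s : R) y z :
  switching_system A -> invariant_norm A f -> 0 <= s ->
  trajectory A y -> trajectory A z -> y s = z 0 ->
  exists w, [/\ trajectory A w, forall t, 0 <= t -> t <= s -> w t = y t &
    forall t, 0 <= t -> w (t + s) = z t].
Proof.
move=> sA iA s0 ty tz yz; have [c c0 H] := trajectory_bounded iA.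
have [A0 cA coA _] := sA; have [K sb] := compact_size_bound cA.
(* Concatenation needs the same [m] on both pieces. *)
pose m := Num.max (c * f (y 0)) (c * f (z 0)).
have iy : integral_solution K m A `[0, +oo[ y.
  by apply: trajectory_integral => // t t0; rewrite le_max H.
have iz : integral_solution K m A `[0, +oo[ z.
  by apply: trajectory_integral => // t t0; rewrite le_max (H z) ?orbT.
pose w t := if t <= s then y t else z (t - s).
have wy t : 0 <= t -> t <= s -> w t = y t by move=> _; rewrite /w => ->.
have wz t : s <= t -> w t = z (t - s).
  rewrite /w => st; case: ifPn => // ts; have -> : t = s by apply/le_anti; rewrite ts.
  by rewrite subrr.
exists w; split=> //.
  apply: (integral_solution_trajectory sb A0 (switching_system_closed sA)).
  exact: (integral_solution_concat sb coA s0 iy iz wy wz).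
by move=> t t0; rewrite wz ?addrK// lerDr.
Qed.

Lemma trajectory_shift (R : realType) d (A : set 'M[R]_d) f (s : R) y :
  switching_system A -> invariant_norm A f -> 0 <= s ->
  trajectory A y -> trajectory A (fun t => y (t + s)).
Proof.
move=> sA iA s0 ty; have [c c0 H] := trajectory_bounded iA.
have [A0 cA coA _] := sA; have [K sb] := compact_size_bound cA.
apply: (integral_solution_trajectory sb A0 (switching_system_closed sA)).
apply: (integral_solution_shift (trajectory_integral sA sb ty (H y ty))) => t.
by rewrite /= !in_itv/= !andbT => t0; exact: addr_ge0.
Qed.

(** Constancy of [f] bounds the stem on the whole line, so one [m] is valid on every half-line. *)
Lemma extremal_stem_trajectory (R : realType) d (A : set 'M[R]_d) f x (tau : R) :
  switching_system A -> invariant_norm A f -> extremal_stem A f x ->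
  trajectory A (fun t => x (t + tau)).
Proof.
move=> sA iA [sx fx]; have [nf _ _] := iA.
have [c c0 H] := norm_function_ge nf.
have [A0 cA coA _] := sA; have [K sb] := compact_size_bound cA.
have clA := switching_system_closed sA.
apply: (integral_solution_trajectory sb A0 clA).
have I : integral_solution K (c * f (x 0)) A `[tau, +oo[ x.
  apply: (solution_integral sb coA clA _ sx) => //.
  by move=> t _; rewrite (fx 0 t).
apply: (integral_solution_shift I) => t.
by rewrite /= !in_itv/= !andbT lerDr.
Qed.

(** * Ivies and eigensets *)

Definition reachable (R : realType) d (A : set 'M[R]_d) (x : R -> 'cV[R]_d) :
    set 'cV[R]_d :=
  \bigcup_(t in `[0, +oo[) flow A (range x) t.

Lemma reachableP (R : realType) d (A : set 'M[R]_d) x p :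
  reachable A x p <-> exists y s tau,
    [/\ trajectory A y, y 0 = x tau, 0 <= s & y s = p].
Proof.
split=> [[s + [y [ty [tau _ xy]] yp]]|[y [s [tau [ty y0 s0 yp]]]]].
  by rewrite /= in_itv/= andbT => s0; exists y, s, tau; split.
exists s; first by rewrite /= in_itv/= s0.
by exists y => //; split=> //; exists tau.
Qed.

Lemma reachable_trajectory (R : realType) d (A : set 'M[R]_d) f x z t :
  switching_system A -> invariant_norm A f -> trajectory A z -> 0 <= t ->
  reachable A x (z 0) -> reachable A x (z t).
Proof.
move=> sA iA tz t0 /reachableP[y [s [tau [ty y0 s0 ys]]]].
have [w [tw wy wz]] := trajectory_concat sA iA s0 ty tz ys.
apply/reachableP; exists w, (t + s), tau; split=> //.
- by rewrite wy.
- exact: addr_ge0.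
- exact: wz.
Qed.

Lemma closure_normP (R : realType) d (P : set 'cV[R]_d) p :
  (forall e, 0 < e -> exists2 q, P q & `|q - p| < e) -> closure P p.
Proof.
move=> H W /nbhs_ballP[e/= e0 eW]; have [q Pq qp] := H e e0.
by exists q; split=> //; apply: eW; rewrite mx_norm_ball /ball_/= distrC.
Qed.

Lemma closure_norm (R : realType) d (P : set 'cV[R]_d) p e :
  closure P p -> 0 < e -> exists2 q, P q & `|q - p| < e.
Proof.
move=> cp e0; have [q [Pq]] := cp _ (nbhsx_ballx p e e0).
by rewrite mx_norm_ball /ball_/= distrC; exists q.
Qed.

Lemma ivy_bounded (R : realType) d (A : set 'M[R]_d) f x m :
  invariant_norm A f ->
  (forall y, trajectory A y -> forall t, 0 <= t -> `|y t| <= m * f (y 0)) ->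
  (forall s t, f (x s) = f (x t)) ->
  forall p, ivy A x p -> `|p| <= m * f (x 0).
Proof.
move=> iA H fx p xp; apply/ler_addgt0Pr => e e0.
have [q /reachableP[y [s [tau [ty y0 s0 <-]]]] qp] := closure_norm xp e0.
have -> : p = y s - (y s - p) by rewrite subKr.
apply: (le_trans (ler_normB _ _)); apply: lerD; last exact: ltW.
by rewrite (fx 0 tau) -y0 H.
Qed.

Lemma ivy_forward (R : realType) d (A : set 'M[R]_d) f x z t :
  switching_system A -> invariant_norm A f -> trajectory A z -> 0 <= t ->
  ivy A x (z 0) -> ivy A x (z t).
Proof.
move=> sA iA tz t0 xz; have [L L0 HL] := trajectory_dependence sA iA.
apply: closure_normP => e e0.
have e'0 : 0 < e / (L + 1) by rewrite divr_gt0// ltr_wpDl.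
have [q Rq qz] := closure_norm xz e'0.
have [y [ty y0 Hy]] := HL z q tz.
exists (y t); first by apply: (reachable_trajectory sA iA ty t0); rewrite y0.
apply: (le_lt_trans (Hy t t0)).
rewrite ltr_pdivlMr ?ltr_wpDl// in qz.
apply: le_lt_trans qz; rewrite mulrC ler_wpM2l// lerDl//.
Qed.

Lemma reachable_backward (R : realType) d (A : set 'M[R]_d) f x p t :
  switching_system A -> invariant_norm A f -> extremal_stem A f x -> 0 <= t ->
  reachable A x p ->
  exists v, [/\ trajectory A v, v t = p, reachable A x (v 0) &
    f (v 0) <= f (x 0)].
Proof.
move=> sA iA ex t0 /reachableP[y [s [tau [ty y0 s0 ys]]]].
have tx := extremal_stem_trajectory (tau - t) sA iA ex.
have xy : x (t + (tau - t)) = y 0 by rewrite y0 addrC subrK.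
have [w [tw wx wy]] := trajectory_concat sA iA t0 tx ty xy.
have w0 : w 0 = x (tau - t) by rewrite wx// add0r.
exists (fun r => w (r + s)); split.
- exact: (trajectory_shift sA iA s0 tw).
- by rewrite addrC wy.
- apply/reachableP; exists w, s, (tau - t); split=> //; by rewrite add0r.
- rewrite add0r; have [_ fd _] := iA; apply: (le_trans (fd _ tw 0 s (lexx _) s0)).
  by rewrite w0; have [_ fx] := ex; rewrite (fx _ 0).
Qed.

Lemma ivy_backward (R : realType) d (A : set 'M[R]_d) f x p t :
  switching_system A -> invariant_norm A f -> extremal_stem A f x -> 0 <= t ->
  ivy A x p -> exists v, [/\ trajectory A v, v t = p & ivy A x (v 0)].
Proof.
move=> sA iA ex t0 xp; have [c c0 Hc] := trajectory_bounded iA.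
have [A0 cA coA _] := sA; have [K sb] := compact_size_bound cA.
have clA := switching_system_closed sA.
have /choice[v Hv] (n : nat) : exists v, [/\ trajectory A v, `|v t - p| <= n.+1%:R^-1,
    reachable A x (v 0) & f (v 0) <= f (x 0)].
  have n0 : 0 < n.+1%:R^-1 :> R by rewrite invr_gt0.
  have [q Rq qp] := closure_norm xp n0.
  have [v [tv vt Rv fv]] := reachable_backward sA iA ex t0 Rq.
  by exists v; split=> //; rewrite vt ltW.
have [U [UU Uoo]] := ultraFilterLemma (F := \oo) _.
have PU : ProperFilter U by exact: ultra_proper.
have iv n : integral_solution K (c * f (x 0)) A `[0, +oo[ (v n).
  have [tv _ _ fv] := Hv n; apply: trajectory_integral => // s s0.
  by apply: (le_trans (Hc _ tv _ s0)); rewrite ler_wpM2l.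
have D (s : R) : 0 <= s -> `[0, +oo[%classic s by move=> s0; rewrite /= in_itv/= s0.
have [w iw vw] := integral_solution_ultralimit (x_ := v) sb clA UU (D 0 (lexx _))
  (fun s Ds => filterE _ (fun=> Ds)) iv.
exists w; split.
- exact: integral_solution_trajectory iw.
- apply/eqP; rewrite -subr_eq0 -normr_eq0 eq_le normr_ge0 andbT.
  apply/ler_addgt0Pr => e e0; rewrite add0r.
  apply: (norm_lim_le PU (cvgB (vw t (D t t0)) (cvg_cst p))).
  apply: Uoo; near=> n; have [_ vn _ _] := Hv n; apply: (le_trans vn).
  by apply: ltW; near: n; exact: near_infty_natSinv_lt (PosNum e0).
- apply: (closed_cvg (ivy A x) (@closed_closure _ _) _ _ (vw 0 (D 0 (lexx _)))).
  by apply: filterE => n; have [_ _ Rv _] := Hv n; exact: subset_closure.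
Unshelve. all: by end_near.
Qed.

Lemma extremal_ivy_eigenset (R : realType) d (A : set 'M[R]_d) f P :
  switching_system A -> invariant_norm A f ->
  extremal_ivy A f P -> P <> [set 0] -> eigenset A P.
Proof.
move=> sA iA [x ex ->] P0; have [c c0 Hc] := trajectory_bounded iA.
have [sx fx] := ex.
split=> //.
- apply: mx_bounded_closed_compact (ivy_bounded iA Hc fx).
  exact: closed_closure.
- have [_ _ /(_ (x 0))[y [ty y0 _]]] := iA.
  exists (x 0); apply: subset_closure; apply/reachableP.
  by exists y, 0, 0; split.
exists 0 => t t0; rewrite mul0r expR0; apply/seteqP; split=> p.
- move=> [z [tz z0] <-]; exists (z t); last by rewrite scale1r.
  exact: (ivy_forward sA iA tz t0 z0).
- move=> [q xq <-]; rewrite scale1r.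
  have [v [tv vt xv]] := ivy_backward sA iA ex t0 xq.
  by exists v.
Qed.

(** * From eigensets to extremal ivies *)

Lemma eigenset_exponent0 (R : realType) d (A : set 'M[R]_d) f (M : set 'cV[R]_d) (alpha : R) :
  invariant_norm A f -> compact M -> M !=set0 -> M <> [set 0] ->
  (forall t : R, 0 <= t -> flow A M t = [set expR (alpha * t) *: p | p in M]) ->
  alpha = 0.
Proof.
move=> iA cM [v0 Mv0] Mn0 HM; have [nf fd fex] := iA.
have [f0 f_eq0 fZ fD] := nf.
have [C C0 fC] := norm_function_le nf.
have [m Hm] : exists m, forall v, M v -> f v <= m.
  have [r [_ Hr]] := compact_bounded cM; exists (C * (r + 1)) => v Mv.
  by apply: (le_trans (fC _)); rewrite ler_wpM2l//; apply: Hr Mv; rewrite ltrDl.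
have [v Mv vn0] : exists2 v, M v & v <> 0.
  apply: contrapT => H; apply: Mn0; apply/seteqP; split=> [w Mw|_ ->] /=.
    by apply: contrapT => wn0; apply: H; exists w.
  have [<-//|/eqP v0n0] := eqVneq v0 0; exfalso; apply: H; by exists v0.
have fv : 0 < f v.
  by rewrite lt_neqAle f0 andbT eq_sym; apply/eqP => /f_eq0.
have m0 : 0 <= m by exact: le_trans (Hm v Mv).
(* If [b > 0], then [expR (b * t) >= 1 + b * t] already exceeds [m / f v] at time [m / f v / b]. *)
have key (b : R) : (forall t : R, 0 <= t -> expR (b * t) * f v <= m) -> b <= 0.
  move=> H; rewrite leNgt; apply/negP => b0.
  have t0 : 0 <= m / f v / b by rewrite !divr_ge0// ltW.
  have := H _ t0; rewrite leNgt => /negP; apply.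
  apply: (@lt_le_trans _ _ ((1 + m / f v) * f v)).
    by rewrite mulrDl mul1r divfK ?gt_eqF// ltrDr.
  rewrite ler_wpM2r ?(ltW fv)//.
  by rewrite mulrCA divff ?gt_eqF// mulr1 expR_ge1Dx.
apply/le_anti/andP; split.
  (* [expR (alpha * t) *: v] is reached from a point of [M], where [f] is at least as large. *)
  apply: key => t t0.
  have [x [tx Mx] xt] : flow A M t (expR (alpha * t) *: v) by rewrite HM//; exists v.
  apply: le_trans (Hm _ Mx); apply: le_trans (fd x tx 0 t (lexx _) t0).
  by rewrite xt fZ ger0_norm// expR_ge0.
(* The invariant trajectory from [v] is in the scaled copy of [M] at time [t], while [f] still
   equals [f v]. *)
rewrite -oppr_le0; apply: key => t t0.
have [x [tx x0 fx]] := fex v.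
have : flow A M t (x t) by exists x => //; split=> //; rewrite x0.
rewrite HM// => -[q Mq xq].
rewrite -(fx t t0) -xq fZ ger0_norm ?expR_ge0// mulrA -expRD.
by rewrite mulNr addNr expR0 mul1r; exact: Hm.
Qed.

Lemma ivy_subset (R : realType) d (A : set 'M[R]_d) (M : set 'cV[R]_d) z :
  closed M -> (forall t : R, 0 <= t -> flow A M t `<=` M) ->
  (forall t, M (z t)) -> ivy A z `<=` M.
Proof.
move=> clM fM Mz; rewrite [X in _ `<=` X]((closure_id M).1 clM).
apply: closure_subset => p /reachableP[y [s [tau [ty y0 s0 <-]]]].
by apply: (fM s s0); exists y => //; split=> //; rewrite y0.
Qed.

(** As [M] is its own image at time [n], some trajectory in [M] is at [p] at time [n]; shifted by
    [n], it passes through [p] at time 0 with a past of length [n]. *)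
Lemma invariant_stem_through (R : realType) d (A : set 'M[R]_d) (K m : R)
    (M : set 'cV[R]_d) p :
  switching_system A -> size_bound A K -> closed M -> (forall v, M v -> `|v| <= m) ->
  (forall t : R, 0 <= t -> flow A M t = M) -> M p ->
  exists x, [/\ integral_solution K m A setT x, x 0 = p & forall t, M (x t)].
Proof.
move=> sA sb clM Mm fM Mp; have clA := switching_system_closed sA.
have /choice[w Hw] (n : nat) : exists w, [/\ trajectory A w, M (w 0) & w n%:R = p].
  have : flow A M n%:R p by rewrite fM.
  by move=> [w [tw Mw] wp]; exists w.
have Mw n t : 0 <= t -> M (w n t).
  by move=> t0; have [tw Mw _] := Hw n; rewrite -(fM t t0); exists (w n).
have [U [UU Uoo]] := ultraFilterLemma (F := \oo) _.
have PU : ProperFilter U by exact: ultra_proper.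
pose x_ n t := w n (t + n%:R).
have DD (t : R) : setT t -> \forall n \near U, `[- n%:R, +oo[%classic t.
  move=> _; apply: Uoo; near=> n; rewrite /= in_itv/= andbT lerNl; near: n.
  exact: nbhs_infty_ger.
have ix n : integral_solution K m A `[- n%:R, +oo[ (x_ n).
  have [tw _ _] := Hw n.
  apply: (@integral_solution_shift _ _ _ _ _ _ `[0, +oo[%classic).
    by apply: trajectory_integral => // t t0; apply: Mm; exact: Mw.
  by move=> t; rewrite /= !in_itv/= !andbT -subr_ge0 opprK.
have [x ixx xx] := integral_solution_ultralimit sb clA UU I DD ix.
exists x; split=> //.
  apply/eqP; rewrite -subr_eq0 -normr_eq0 eq_le normr_ge0 andbT.
  apply: (norm_lim_le PU (cvgB (xx 0 I) (cvg_cst p))).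
  by apply: filterE => n; rewrite /x_ add0r; have [_ _ ->] := Hw n; rewrite subrr normr0.
move=> t; apply: (closed_cvg M clM _ _ (xx t I)).
apply: filterS (DD t I) => n; rewrite /= in_itv/= andbT => nt.
by apply: Mw; rewrite -subr_ge0 opprK in nt.
Unshelve. all: by end_near.
Qed.

Lemma extremal_ivy_through (R : realType) d (A : set 'M[R]_d) f (M : set 'cV[R]_d) p :
  switching_system A -> invariant_norm A f -> compact M ->
  (forall t : R, 0 <= t -> flow A M t = M) -> M p ->
  exists P, [/\ extremal_ivy A f P, P `<=` M & P p].
Proof.
move=> sA iA cM fM Mp; have [nf fd _] := iA.
have clM : closed M by apply: compact_closed => //; exact: norm_hausdorff.
have [A0 cA coA _] := sA; have [K sb] := compact_size_bound cA.
have clA := switching_system_closed sA.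
have [m Mm] : exists m, forall v, M v -> `|v| <= m.
  have [r [_ Hr]] := compact_bounded cM; exists (r + 1) => v Mv.
  by apply: Hr Mv; rewrite ltrDl.
have [x [ix x0 Mx]] := invariant_stem_through sA sb clM Mm fM Mp.
have tx tau : trajectory A (fun t => x (t + tau)).
  apply: (integral_solution_trajectory sb A0 clA (m := m)).
  exact: (integral_solution_shift ix).
have fx s t : s <= t -> f (x t) <= f (x s).
  move=> st; have := fd _ (tx s) 0 (t - s) (lexx _).
  by rewrite subr_ge0 => /(_ st); rewrite subrK add0r.
have [C C0 fC] := norm_function_le nf.
have supx : has_sup (range (f \o x)).
  split; first by exists (f (x 0)), 0.
  exists (C * m) => _ [t _ <-] /=; apply: (le_trans (fC _)).
  by rewrite ler_wpM2l// Mm.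
(* Since [f] does not increase along [x], this supremum is the limit at minus infinity, and hence
   the value of [f] all along a limit of the shifts. *)
pose c := sup (range (f \o x)).
have fxc t : f (x t) <= c by apply: sup_upper_bound => //; exists t.
have [U [UU Uoo]] := ultraFilterLemma (F := \oo) _.
have PU : ProperFilter U by exact: ultra_proper.
have iz (n : nat) : integral_solution K m A setT (fun t => x (t + - n%:R)).
  exact: (integral_solution_shift ix).
have [z izz xz] := integral_solution_ultralimit (D := setT) sb clA UU I
   (fun t _ => filterE _ (fun=> I)) iz.
have Mz t : M (z t).
  by apply: (closed_cvg M clM _ _ (xz t I)); apply: filterE => n; exact: Mx.
have near_z t e : 0 < e -> \forall n \near U, `|z t - x (t + - n%:R)| <= e.
  by move=> e0; have /cvgrPdist_le := xz t I; exact.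
have fz t : f (z t) = c.
  have H : `|f (z t) - c| <= 0; last first.
    by apply/eqP; rewrite -subr_eq0 -normr_eq0 eq_le H normr_ge0.
  apply/ler_addgt0Pr => e e0; rewrite add0r.
  have e20 : 0 < e / 2 by rewrite divr_gt0.
  have e'0 : 0 < e / 2 / (C + 1) by rewrite divr_gt0// ltr_wpDl.
  have [_ [s _ <-] cs] := sup_adherent e20 supx.
  (* Up to time [s] the values of [f] along [x] lie between [f (x s)] and [c], which differ by less
     than [e / 2]. *)
  have H1 : \forall n \near U, t + - n%:R <= s.
    apply: Uoo; near=> n; rewrite lerBlDl -lerBlDr; near: n.
    exact: nbhs_infty_ger.
  have [n [Hn1 Hn2]] := filter_ex (filterI H1 (near_z t _ e'0)).
  have -> : f (z t) - c = (f (z t) - f (x (t + - n%:R))) + (f (x (t + - n%:R)) - c).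
    by rewrite subrKA.
  apply: (le_trans (ler_normD _ _)); rewrite [leRHS]splitr; apply: lerD.
    apply: (le_trans (norm_function_distr nf fC _ _)).
    rewrite ler_pdivlMr ?ltr_wpDl// in Hn2; apply: le_trans Hn2.
    by rewrite mulrC ler_wpM2l// lerDl.
  rewrite ler0_norm ?subr_le0// opprB lerBlDr -lerBlDl.
  by apply: le_trans (fx _ _ Hn1); exact: ltW.
have sz : extremal_stem A f z.
  split; last by move=> s t; rewrite !fz.
  exact: integral_solution_stem izz.
exists (ivy A z); split; first by exists z.
  by apply: ivy_subset => // t t0; rewrite fM.
have [L L0 HL] := trajectory_dependence sA iA.
apply: closure_normP => e e0.
have e'0 : 0 < e / (L + 1) / 2 by rewrite !divr_gt0// ltr_wpDl.
have [n Hn] := filter_ex (near_z 0 _ e'0).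
(* [y] starts on the stem [z] and stays close to the shifted [x], which is at [p] at time [n]. *)
have [y [ty y0 Hy]] := HL _ (z 0) (tx (- n%:R)).
exists (y n%:R).
  by apply/reachableP; exists y, n%:R, 0; split.
have := Hy n%:R (ler0n _ _); rewrite subrr x0 => /le_lt_trans; apply.
apply: (@le_lt_trans _ _ (L * (e / (L + 1) / 2))); first by rewrite ler_wpM2l.
apply: (@lt_le_trans _ _ ((L + 1) * (e / (L + 1)))); last first.
  by rewrite mulrC divfK// gt_eqF// ltr_wpDl.
have q0 : 0 < e / (L + 1) by rewrite divr_gt0// ltr_wpDl.
nra.
Unshelve. all: by end_near.
Qed.

Theorem theorem3 (R : realType) (d : nat) (A : set 'M[R]_d)
    (f : 'cV[R]_d -> R) :
  switching_system A -> normalized A -> invariant_norm A f ->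
  (forall P : set 'cV[R]_d,
     extremal_ivy A f P -> P <> [set 0] -> eigenset A P) /\
  (irreducible A ->
   forall M : set 'cV[R]_d, eigenset A M ->
     exists2 S : set (set 'cV[R]_d),
       S `<=` extremal_ivy A f & M = \bigcup_(P in S) P).
Proof.
move=> sA _ iA; split=> [P|_ M [cM M0 Mn0 [alpha HM]]].
  exact: extremal_ivy_eigenset.
have alpha0 := eigenset_exponent0 iA cM M0 Mn0 HM.
have fM (t : R) : 0 <= t -> flow A M t = M.
  move=> t0; rewrite HM// alpha0 mul0r expR0.
  by under eq_imagel do rewrite scale1r; rewrite image_id.
(* The largest candidate for [S]: only the covering of [M] remains to be shown. *)
exists [set P | extremal_ivy A f P /\ P `<=` M]; first by move=> P [].
apply/seteqP; split=> [p Mp|p [P [_ PM] Pp]]; last exact: PM.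
by have [P [eP PM Pp]] := extremal_ivy_through sA iA cM fM Mp; exists P.
Qed.
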